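(* There exists a data structure supporting the following procedures: (1) $\textsc{Init}(\{v_1,\ldots,v_m\}\subseteq\mathbb{R}^d)$: takes a sequence of vectors $v_1,\ldots,v_m$ as input and preprocesses in time $O(md^{\omega-1})$ and space $O(md)$; (2) $\textsc{QueryPositiveSearch}(A\in\mathbb{R}^{d\times d})$: given a matrix $A$ with the promise that $\sum_{i=1}^m\langle M_i,A\rangle>0$, where $M_i=v_iv_i^\top$, returns an index $i$ such that $\langle M_i,A\rangle>0$, in time $O(d^2\log m+d^\omega)$.
   Context: For matrices $A,B\in\mathbb{R}^{d\times d}$, $\langle A,B\rangle=\mathrm{tr}[A^\top B]$. $\omega$ denotes the exponent of matrix multiplication. *)

(* Defs.v *)
From HB Require Import structures.
From mathcomp Require Import all_boot all_order all_algebra.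
From mathcomp Require Import classical_sets reals exp.

Set Implicit Arguments.
Unset Strict Implicit.
Unset Printing Implicit Defensive.

Import Order.TTheory GRing.Theory Num.Theory.
Local Open Scope ring_scope.

(* Model of computation: the algebraic computation tree over the reals, with a
   read-only input indexed by I and an unbounded read-write memory of real
   cells.  Every ring operation and every comparison costs one unit; constants
   are free.  A program is written for fixed problem dimensions, and data enter
   its control flow only through the comparisons it pays for. *)
Section Machine.
Variables (R : realType) (I : Type).

Definition memory := nat -> R.

Inductive operand : Type :=
| Inp of I
| Mem of nat
| Cst of R.

Inductive ring_op : Type := Add | Sub | Mul.

(* Instr a o x y stores (x o y) in memory cell a. *)
Record instr : Type := Instr
  { target : nat; oper : ring_op; lhs : operand; rhs : operand }.

Inductive prog (T : Type) : Type :=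
| Ret of T
| Do of instr & prog T
| IfLt of operand & operand & prog T & prog T.

Definition eval_operand (inp : I -> R) (mu : memory) (x : operand) : R :=
  match x with
  | Inp i => inp i
  | Mem a => mu a
  | Cst c => c
  end.

Definition eval_op (o : ring_op) (x y : R) : R :=
  match o with
  | Add => x + y
  | Sub => x - y
  | Mul => x * y
  end.

Definition step (inp : I -> R) (mu : memory) (c : instr) : memory :=
  fun a => if a == target c
           then eval_op (oper c) (eval_operand inp mu (lhs c))
                                 (eval_operand inp mu (rhs c))
           else mu a.

Fixpoint run T (p : prog T) (inp : I -> R) (mu : memory) : T * memory :=
  match p with
  | Ret t => (t, mu)
  | Do c p' => run p' inp (step inp mu c)
  | IfLt x y p1 p2 =>
      if eval_operand inp mu x < eval_operand inp mu y
      then run p1 inp mu else run p2 inp mu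
  end.

Definition result T (p : prog T) inp mu : T := (run p inp mu).1.
Definition final_memory T (p : prog T) inp mu : memory := (run p inp mu).2.

Fixpoint run_time T (p : prog T) (inp : I -> R) (mu : memory) : nat :=
  match p with
  | Ret _ => 0
  | Do c p' => (run_time p' inp (step inp mu c)).+1
  | IfLt x y p1 p2 =>
      (if eval_operand inp mu x < eval_operand inp mu y
       then run_time p1 inp mu else run_time p2 inp mu).+1
  end.

Definition operand_cells (x : operand) : seq nat :=
  if x is Mem a then [:: a] else [::].

Definition instr_cells (c : instr) : seq nat :=
  target c :: operand_cells (lhs c) ++ operand_cells (rhs c).

Fixpoint cells T (p : prog T) (inp : I -> R) (mu : memory) : seq nat :=
  match p with
  | Ret _ => [::]
  | Do c p' => instr_cells c ++ cells p' inp (step inp mu c)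
  | IfLt x y p1 p2 =>
      operand_cells x ++ operand_cells y ++
      (if eval_operand inp mu x < eval_operand inp mu y
       then cells p1 inp mu else cells p2 inp mu)
  end.

(* All the cells touched by the run count, scratch memory included. *)
Definition space_used T (p : prog T) inp mu : nat := size (undup (cells p inp mu)).

End Machine.

Section MatrixMultiplication.
Variable R : realType.

Definition mm_index (n : nat) : Type := ('I_n * 'I_n + 'I_n * 'I_n)%type.

Definition mm_input n (A B : 'M[R]_n) (ij : mm_index n) : R :=
  match ij with
  | inl (i, j) => A i j
  | inr (i, j) => B i j
  end.

(* The straight-line program s, started with arbitrary memory contents, leaves
   the entries of A *m B at the places designated by out. *)
Definition computes_mm n (s : seq (instr R (mm_index n)))
    (out : 'I_n -> 'I_n -> operand R (mm_index n)) : Prop :=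
  forall (A B : 'M[R]_n) (mu : memory R) (i j : 'I_n),
    eval_operand (mm_input A B) (foldl (step (mm_input A B)) mu s) (out i j)
    = (A *m B) i j.

(* Two n x n matrices can be multiplied in O(n ^ w) arithmetic operations. *)
Definition mm_exponent (w : R) : Prop :=
  exists C : R, forall n : nat, (0 < n)%N ->
    exists (s : seq (instr R (mm_index n)))
           (out : 'I_n -> 'I_n -> operand R (mm_index n)),
      computes_mm s out /\ (size s)%:R <= C * n%:R `^ w.

Definition omega : R := inf [set w | mm_exponent w]%classic.

End MatrixMultiplication.

Section PositiveSearch.
Variable R : realType.

Definition mx_inner d (A B : 'M[R]_d) : R := \tr (A^T *m B).

Definition rank_one d (v : 'cV[R]_d) : 'M[R]_d := v *m v^T.

Record search_structure (m d : nat) : Type := SearchStructure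
  { init : prog R ('I_m * 'I_d)%type unit;
    query : prog R ('I_d * 'I_d)%type nat }.

Definition init_input m d (v : 'I_m -> 'cV[R]_d) (ik : 'I_m * 'I_d) : R :=
  v ik.1 ik.2 0.

Definition query_input d (A : 'M[R]_d) (kl : 'I_d * 'I_d) : R :=
  A kl.1 kl.2.

Definition promise m d (v : 'I_m -> 'cV[R]_d) (A : 'M[R]_d) : Prop :=
  0 < \sum_(i < m) mx_inner (rank_one (v i)) A.

(* The memory states in which a query may be asked: Init has been run on v
   (from an arbitrary memory), followed by any number of queries that satisfy
   the promise.  A query sees v only through this memory. *)
Inductive reachable m d (ds : search_structure m d) (v : 'I_m -> 'cV[R]_d) :
    memory R -> Prop :=
| after_init (mu : memory R) :
    reachable ds v (final_memory (init ds) (init_input v) mu)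
| after_query (mu : memory R) (A : 'M[R]_d) :
    reachable ds v mu -> promise v A ->
    reachable ds v (final_memory (query ds) (query_input A) mu).

End PositiveSearch.

(* Main.v *)
(** Init cuts the vectors into blocks of d and stores the vectors together with
    the prefix sums, block after block, of the matrices v_i v_i^T; each block
    costs one matrix product V V^T. The inner product of a prefix sum with A is
    0 for the empty prefix and positive for the whole sequence, so a binary search
    over the O(m / d) prefixes, at O(d^2) per step, finds a block whose sum has
    a positive inner product with A. One more product A V gives all the numbers
    v_i^T A v_i of this block.

    The scratch memory of Init must be O(m d), hence the products V V^T must be
    computed in O(d^2) cells, which a straight-line program witnessing the
    exponent w need not achieve. Strassen's argument extracts from it a bilinear
    algorithm, which also applies to matrices with matrix entries: used on q x q
    blocks of size t x t with t^w ~ n^2 and q t ~ n, the original program being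
    run on the t x t products only, it multiplies n x n matrices in O(n^w)
    operations and O(n^2) cells. *)

From mathcomp Require Import all_boot all_order all_algebra.
From mathcomp Require Import classical_sets reals exp boolp.
From mathcomp Require Import zify ring lra.
Require Import Defs.

Set Implicit Arguments.
Unset Strict Implicit.
Unset Printing Implicit Defensive.

Import Order.TTheory GRing.Theory Num.Theory.
Local Open Scope ring_scope.

Arguments Inp {R I} _.
Arguments Mem {R I} _.
Arguments Cst {R I} _.
Arguments Ret {R I T} _.
Local Notation exec inp mu s := (foldl (step inp) mu s).

(** * Straight-line programs: the cells they touch and the inner products they compute *)

Section StraightLine.
Variables (R : realType) (I : Type).
Implicit Types (inp : I -> R) (mu : memory R) (s : seq (instr R I)).
Implicit Types (x y : operand R I).

Definition code_cells s : seq nat := flatten [seq instr_cells c | c <- s].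

Definition within N s : bool := all (ltn^~ N) (code_cells s).

Lemma within_cat N s1 s2 : within N (s1 ++ s2) = within N s1 && within N s2.
Proof. by rewrite /within /code_cells map_cat flatten_cat all_cat. Qed.

Lemma within_flatten (J : Type) N (f : J -> seq (instr R I)) (e : seq J) :
  (forall j, within N (f j)) -> within N (flatten [seq f j | j <- e]).
Proof. by move=> fN; elim: e => //= j e IHe; rewrite within_cat fN. Qed.

Lemma size_flatten_le (J T : Type) k (f : J -> seq T) (e : seq J) :
  (forall j, size (f j) <= k)%N ->
  (size (flatten [seq f j | j <- e]) <= size e * k)%N.
Proof.
by move=> fk; elim: e => //= j e IHe; rewrite size_cat mulSn leq_add.
Qed.

Lemma target_code_cells s : {subset map (@target R I) s <= code_cells s}.
Proof.
elim: s => //= c s IHs a; rewrite inE => /predU1P[->|/IHs].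
  exact: mem_head.
by rewrite /code_cells /= inE mem_cat => ->; rewrite !orbT.
Qed.

Lemma eq_eval_operand inp mu1 mu2 x :
  {in operand_cells x, mu1 =1 mu2} ->
  eval_operand inp mu1 x = eval_operand inp mu2 x.
Proof. by case: x => //= a; apply; rewrite mem_head. Qed.

(** With [keep] the products are added to the old content of [acc]; otherwise [acc] is cleared
    first, since the initial memory is arbitrary. Pairs whose first component is [Cst 1] serve to
    copy or add plain values. *)
Definition dot_code (keep : bool) (tmp acc : nat)
    (l : seq (operand R I * operand R I)) : seq (instr R I) :=
  (if keep then [::] else [:: Instr acc Add (Cst 0) (Cst 0)]) ++
  flatten [seq [:: Instr tmp Mul xy.1 xy.2; Instr acc Add (Mem acc) (Mem tmp)]
          | xy <- l].

Lemma size_dot_code keep tmp acc l :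
  size (dot_code keep tmp acc l) = (~~ keep + (size l).*2)%N.
Proof.
rewrite size_cat; congr addn; first by case: keep.
by elim: l => //= xy l ->.
Qed.

Lemma within_dot_code N keep tmp acc l :
  (tmp < N)%N -> (acc < N)%N ->
  all (fun xy => all (ltn^~ N) (operand_cells xy.1 ++ operand_cells xy.2)) l ->
  within N (dot_code keep tmp acc l).
Proof.
move=> tmpN accN lN; rewrite within_cat; apply/andP; split.
  by case: keep; rewrite /within /= ?accN.
elim: l lN => //= xy l IHl /andP[xyN lN].
rewrite (within_cat N [:: _; _]) IHl // andbT.
move: xyN; rewrite /within /code_cells /= !all_cat => /andP[-> ->] /=.
by rewrite accN tmpN.
Qed.

Definition avoids (W : pred nat) x : bool := all (predC W) (operand_cells x).

Lemma eval_operand_avoids (W : pred nat) inp mu1 mu2 x :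
  {in predC W, mu1 =1 mu2} -> avoids W x ->
  eval_operand inp mu1 x = eval_operand inp mu2 x.
Proof. by move=> mu12 /allP Wx; apply: eq_eval_operand => c /Wx /mu12. Qed.

Definition avoids2 (W : pred nat) (xy : operand R I * operand R I) : bool :=
  avoids W xy.1 && avoids W xy.2.

(** Both [tmp] and [acc] change while the operands are being read, so no operand may refer to
    them. *)
Lemma exec_dot_code keep tmp acc l inp mu c :
  acc != tmp -> all (avoids2 (pred2 tmp acc)) l -> c != tmp ->
  exec inp mu (dot_code keep tmp acc l) c =
  if c == acc then
    (if keep then mu acc else 0) +
    \sum_(xy <- l) eval_operand inp mu xy.1 * eval_operand inp mu xy.2
  else mu c.
Proof.
move=> acctmp lW ctmp; rewrite foldl_cat.
set mu0 := exec inp mu _.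
have mu0E a : mu0 a = if a == acc then (if keep then mu acc else 0) else mu a.
  rewrite /mu0 {mu0}; case: keep => /=; first by case: eqP => // ->.
  by rewrite /step /= addr0.
have mu0mu : {in predC (pred2 tmp acc), mu0 =1 mu}.
  by move=> a; rewrite !inE mu0E => /norP[_ /negbTE->].
have ->: (if keep then mu acc else 0) = mu0 acc by rewrite mu0E eqxx.
transitivity (if c == acc then mu0 acc +
    \sum_(xy <- l) eval_operand inp mu xy.1 * eval_operand inp mu xy.2
    else mu0 c); last by case: ifP => // cacc; rewrite mu0E cacc.
clearbody mu0; elim: l lW mu0 mu0mu {mu0E} => [|xy l IHl] /= lW mu0 mu0mu.
  by rewrite big_nil addr0; case: eqP => // ->.
have /andP[/andP[xW yW] {}lW] := lW.
rewrite IHl // => [|a]; last first.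
  rewrite !inE => /norP[/negbTE atmp /negbTE aacc]; rewrite /step /= aacc atmp.
  by apply: mu0mu; rewrite !inE atmp aacc.
rewrite big_cons /step /= !eqxx (negbTE acctmp) (negbTE ctmp).
rewrite !(eval_operand_avoids (W := pred2 tmp acc) inp mu0mu) //.
by rewrite addrA; case: (c == acc).
Qed.

Section Dots.
Variables (J : finType) (keep : bool) (tmp : nat) (acc : J -> nat).
Variable l : J -> seq (operand R I * operand R I).

Definition dots_code (e : seq J) : seq (instr R I) :=
  flatten [seq dot_code keep tmp (acc j) (l j) | j <- e].

(** Operands that avoid these cells keep their values during the whole family of inner products,
    whatever the order of computation. *)
Definition dots_writes : pred nat := [pred c | (c == tmp) || (c \in codom acc)].

Lemma size_dots_code k e :
  (forall j, size (l j) <= k)%N -> (size (dots_code e) <= size e * k.*2.+1)%N.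
Proof.
move=> lk; apply: size_flatten_le => j; rewrite size_dot_code -add1n.
by rewrite leq_add ?leq_double //; case: keep.
Qed.

Lemma within_dots_code N e :
  (tmp < N)%N -> (forall j, acc j < N)%N ->
  (forall j, all (fun xy => all (ltn^~ N)
     (operand_cells xy.1 ++ operand_cells xy.2)) (l j)) ->
  within N (dots_code e).
Proof.
by move=> tN aN lN; apply: within_flatten => j; apply: within_dot_code.
Qed.

Hypotheses (acc_inj : injective acc) (acc_tmp : forall j, acc j != tmp).
Hypothesis l_avoids : forall j, all (avoids2 dots_writes) (l j).

Let l_avoids1 j : all (avoids2 (pred2 tmp (acc j))) (l j).
Proof.
apply: sub_all (l_avoids j) => xy /andP[xW yW].
apply/andP; split; [apply: sub_all xW|apply: sub_all yW] => a;
  by apply: contra => /pred2P[->|->]; apply/orP;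
     [left|right; apply: codom_f].
Qed.

Lemma exec_dots_code_other e inp mu c :
  c \notin dots_writes -> exec inp mu (dots_code e) c = mu c.
Proof.
elim: e mu => //= j e IHe mu cW; rewrite foldl_cat IHe //.
move: (cW); rewrite !inE => /norP[ctmp cacc].
rewrite exec_dot_code ?l_avoids1 // ifN //.
by apply: contraNneq cacc => ->; apply: codom_f.
Qed.

Lemma exec_dots_code e inp mu j : uniq e ->
  exec inp mu (dots_code e) (acc j) =
  if j \in e then (if keep then mu (acc j) else 0) +
    \sum_(xy <- l j) eval_operand inp mu xy.1 * eval_operand inp mu xy.2
  else mu (acc j).
Proof.
elim: e mu => //= k e IHe mu /andP[kNe Ue]; rewrite foldl_cat IHe //.
rewrite !exec_dot_code ?l_avoids1 // in_cons (inj_eq acc_inj).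
case: (eqVneq j k) => [->|jk] //=; first by rewrite (negbTE kNe).
case: ifP => // _; congr (_ + _).
(* Writing the list as its own filter makes the avoidance condition available for each term of the
   sum. *)
have /all_filterP <- := l_avoids j.
rewrite !big_filter; apply: eq_bigr => xy /andP[xW yW].
suff mu_eq : {in predC dots_writes,
  exec inp mu (dot_code keep tmp (acc k) (l k)) =1 mu}.
  by congr (_ * _); apply: eval_operand_avoids mu_eq _.
move=> c; rewrite !inE => /norP[ctmp cacc].
rewrite exec_dot_code ?l_avoids1 // ifN //.
by apply: contraNneq cacc => ->; apply: codom_f.
Qed.

End Dots.

End StraightLine.

(** * Renaming of cells and substitution of operands for inputs *)

Section Translation.
Variables (R : realType) (I J : Type).
Variables (f : I -> operand R J) (g : nat -> nat).

Definition translate_operand (x : operand R I) : operand R J :=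
  match x with
  | Inp i => f i
  | Mem a => Mem (g a)
  | Cst c => Cst c
  end.

Definition translate_instr (c : instr R I) : instr R J :=
  Instr (g (target c)) (oper c)
        (translate_operand (lhs c)) (translate_operand (rhs c)).

Definition translate (s : seq (instr R I)) : seq (instr R J) :=
  map translate_instr s.

Lemma exec_translate_other inp mu s c :
  (forall a, g a != c) -> exec inp mu (translate s) c = mu c.
Proof.
move=> gc; elim: s mu => //= i s IHs mu; rewrite IHs /step /=.
by rewrite eq_sym (negbTE (gc _)).
Qed.

Hypotheses (g_inj : injective g).
Hypothesis f_avoids : forall i a, g a \notin operand_cells (f i).

(** By [f_avoids] no renamed cell occurs in an operand that stands for an input, so the simulated
    inputs stay constant throughout the run. *)
Lemma exec_translate inp mu s x :
  eval_operand inp (exec inp mu (translate s)) (translate_operand x) =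
  let inp' i := eval_operand inp mu (f i) in
  eval_operand inp' (exec inp' (mu \o g) s) x.
Proof.
move=> /=; set inp' := fun i => eval_operand inp mu (f i).
have evalE mu1 mu2 y :
    mu1 \o g =1 mu2 -> (forall i, eval_operand inp mu1 (f i) = inp' i) ->
    eval_operand inp mu1 (translate_operand y) = eval_operand inp' mu2 y.
  by move=> mu12 fE; case: y => //= a; rewrite -mu12.
suff H mu1 mu2 : mu1 \o g =1 mu2 ->
    (forall i, eval_operand inp mu1 (f i) = inp' i) ->
    eval_operand inp (exec inp mu1 (translate s)) (translate_operand x) =
    eval_operand inp' (exec inp' mu2 s) x by exact: H.
move=> mu12 fE; elim: s mu1 mu2 mu12 fE => [|c s IHs] mu1 mu2 mu12 fE /=.
  exact: evalE.
apply: IHs => [a|i].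
  by rewrite /step /= (inj_eq g_inj) !(evalE _ mu2) // -mu12.
rewrite -fE; apply: eq_eval_operand => a af; rewrite /step /=.
by case: eqP => // ae; have := f_avoids i (target c); rewrite -ae af.
Qed.

Lemma within_translate M s :
  (forall a, a \in code_cells s -> g a < M)%N ->
  (forall i, all (ltn^~ M) (operand_cells (f i))) -> within M (translate s).
Proof.
move=> + fM; elim: s => //= c s IHs sM.
rewrite (within_cat M [:: _]) IHs ?andbT; last first.
  by move=> b bs; apply: sM; rewrite /code_cells /= inE mem_cat bs !orbT.
rewrite /within /= sM ?mem_head //= cats0 all_cat.
have opM x : {subset operand_cells x <= code_cells (c :: s)} ->
    all (ltn^~ M) (operand_cells (translate_operand x)).
  by case: x => //= a xs; rewrite sM // xs ?mem_head.
by apply/andP; split; apply: opM => a ac;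
  rewrite /code_cells /= inE !mem_cat ac ?orbT.
Qed.

End Translation.

(** * Straight-line code followed by a branching program *)

Section Programs.
Variables (R : realType) (I T : Type).
Implicit Types (inp : I -> R) (mu : memory R) (p : prog R I T).

Definition then_run (s : seq (instr R I)) p : prog R I T :=
  foldr (@Do R I T) p s.

Lemma run_then_run s p inp mu :
  run (then_run s p) inp mu = run p inp (exec inp mu s).
Proof. by elim: s mu => /=. Qed.

Lemma run_time_then_run s p inp mu :
  run_time (then_run s p) inp mu = (size s + run_time p inp (exec inp mu s))%N.
Proof. by elim: s mu => //= c s IHs mu; rewrite IHs. Qed.

Lemma cells_then_run s p inp mu :
  cells (then_run s p) inp mu = code_cells s ++ cells p inp (exec inp mu s).
Proof. by elim: s mu => [|c s IHs] mu //; rewrite [LHS]/= IHs catA. Qed.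

Lemma space_used_within N s t inp mu :
  within N s -> (space_used (then_run s (Ret t)) inp mu <= N)%N.
Proof.
move=> sN; rewrite /space_used cells_then_run cats0 -[leqRHS](size_iota 0).
apply: uniq_leq_size; first exact: undup_uniq.
by move=> c; rewrite mem_undup mem_iota => /(allP sN).
Qed.

End Programs.

(** * Outputs and size of matrix multiplication programs *)

Section MatrixProductCode.
Variables (R : realType) (n : nat).
Implicit Types (s : seq (instr R (mm_index n))).

Lemma exec_untouched (I : Type) (inp : I -> R) mu (s : seq (instr R I)) c :
  c \notin map (@target R I) s -> exec inp mu s c = mu c.
Proof.
elim: s mu => //= i s IHs mu; rewrite inE => /norP[ci cs].
by rewrite IHs // /step (negbTE ci).
Qed.

(* No output can be an input, a constant or an unwritten cell, and no two
   outputs can share a cell. *)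
Lemma mm_outputs s out : computes_mm s out ->
  exists a : 'I_n * 'I_n -> nat,
    [/\ injective a, forall i j, out i j = Mem (a (i, j))
      & forall ij, a ij \in map (@target R _) s].
Proof.
move=> sP.
have nE (i : 'I_n) : (n%:R : R) != 0.
  by rewrite pnatr_eq0 -lt0n (leq_trans _ (ltn_ord i)).
have outP i j : exists2 a, out i j = Mem a & a \in map (@target R _) s.
  (* The entries of the product of two zero matrices are 0 and those of the product of two all-one
     matrices are n. No constant is both, and an unwritten cell that initially holds 1 does not
     become 0. *)
  have out0 mu : eval_operand (mm_input 0 0)
      (exec (mm_input 0 0) mu s) (out i j) = 0.
    by rewrite sP mul0mx mxE.
  have out1 mu : eval_operand (mm_input (const_mx 1) (const_mx 1))
      (exec (mm_input (const_mx 1) (const_mx 1)) mu s) (out i j) = n%:R.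
    rewrite sP mxE (eq_bigr (fun=> 1)) => [|k _]; last by rewrite !mxE mulr1.
    by rewrite sumr_const card_ord.
  case E: (out i j) => [k|a|c].
  - case: k E => [] [k l] E; exfalso.
      have := sP (const_mx 1) 0 (fun=> 0) i j.
      by rewrite E mulmx0 /= !mxE => /eqP; rewrite oner_eq0.
    have := sP 0 (const_mx 1) (fun=> 0) i j.
    by rewrite E mul0mx /= !mxE => /eqP; rewrite oner_eq0.
  - exists a => //; apply/negPn/negP => aNs.
    have := out0 (fun=> 1); rewrite E /= exec_untouched // => /eqP.
    by rewrite oner_eq0.
  - exfalso; have := out1 (fun=> 0); have := out0 (fun=> 0); rewrite E /= => ->.
    by move/eqP; rewrite eq_sym (negbTE (nE i)).
pose Q (ij : 'I_n * 'I_n) a :=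
  out ij.1 ij.2 = Mem a /\ a \in map (@target R _) s.
have /(fin_all_exists (P := Q))[a aP] : forall ij, exists a, Q ij a.
  by move=> ij; have [a] := outP ij.1 ij.2; exists a.
exists a; split=> [[i j] [k l] /= akl|i j|ij];
  [|exact: (aP (i, j)).1|exact: (aP ij).2].
(* The product [delta_mx i i *m delta_mx i j] is nonzero only at (i, j), so an output sharing the
   cell of this one coincides with it. *)
have := sP (delta_mx i i) (delta_mx i j) (fun=> 0) k l.
have := sP (delta_mx i i) (delta_mx i j) (fun=> 0) i j.
rewrite (aP (i, j)).1 (aP (k, l)).1 akl => ->.
rewrite mul_delta_mx !mxE !eqxx /= => /eqP.
case: (eqVneq k i) => [->|_]; case: (eqVneq l j) => [->|_] //=;
  by rewrite oner_eq0.
Qed.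

(** Each instruction writes one cell, and the outputs occupy distinct written cells. *)
Lemma mm_code_size s out : computes_mm s out -> (n * n <= size s)%N.
Proof.
move=> /mm_outputs[a [a_inj _ as_]].
rewrite -(size_map (@target R _)) -[X in (X * X)%N]card_ord -card_prod.
rewrite -(size_codom a); apply: uniq_leq_size.
  by rewrite /codom map_inj_uniq // enum_uniq.
by move=> _ /codomP[ij ->].
Qed.

Lemma naive_mm :
  exists s out, @computes_mm R n s out /\ (size s <= n * n * n.*2.+1)%N.
Proof.
pose acc (ij : 'I_n * 'I_n) : nat := (enum_rank ij).+1.
pose l (ij : 'I_n * 'I_n) : 
    seq (operand R (mm_index n) * operand R (mm_index n)) :=
  [seq (Inp (inl (ij.1, k)), Inp (inr (k, ij.2))) | k <- enum 'I_n].
exists (dots_code false 0 acc l (enum {: 'I_n * 'I_n})).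
exists (fun i j => Mem (acc (i, j))); split=> [A B mu i j /=|].
  rewrite exec_dots_code ?enum_uniq // => [|p q [/val_inj/enum_rank_inj] //|p].
    rewrite mem_enum inE add0r /l big_map big_enum mxE.
    exact: eq_bigr.
  by rewrite all_map; apply/allP.
have l_size ij : (size (l ij) <= n)%N by rewrite size_map size_enum_ord.
rewrite (leq_trans (size_dots_code _ _ _ _ l_size)) //.
by rewrite -cardE card_prod card_ord.
Qed.

End MatrixProductCode.

(** * The exponent of matrix multiplication *)

Section Exponent.
Variable R : realType.

(** The set whose infimum is [omega] is thus nonempty. *)
Lemma mm_exponent3 : mm_exponent (3%:R : R).
Proof.
exists 3%:R => n n_gt0; have [s [out [sP s_le]]] := naive_mm R n.
exists s, out; split=> //.
rewrite powR_mulrn ?ler0n // -natrX -natrM ler_nat (leq_trans s_le) //.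
nia.
Qed.

(** Writing the n^2 outputs gives n^2 <= C n^w for every n > 0; if w < 2, this fails once n >
    C^(1/(2 - w)). The set defining [omega] is thus bounded below. *)
Lemma mm_exponent_ge2 (w : R) : mm_exponent w -> 2%:R <= w.
Proof.
case=> C wC; rewrite leNgt; apply/negP => w_lt2.
pose u := (2%:R - w)^-1; have u_gt0 : 0 < u by rewrite invr_gt0 subr_gt0.
have C_ge1 : 1 <= C.
  have [s [out [sP]]] := wC 1%N isT.
  by rewrite powR1 mulr1; apply: le_trans; rewrite ler1n (mm_code_size sP).
pose n := (Num.truncn (C `^ u)).+1.
have Cn : C `^ u < n%:R by exact: truncnS_gt.
have [s [out [sP]]] := wC n isT; apply/negP; rewrite -ltNge.
apply: lt_le_trans (_ : n%:R `^ 2%:R <= _); last first.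
  by rewrite powR_mulrn // -natrX ler_nat -mulnn (mm_code_size sP).
have -> : 2%:R = (2%:R - w) + w by rewrite subrK.
rewrite powRD ?pnatr_eq0 ?implybT // ltr_pM2r ?powR_gt0 //.
have -> : C = (C `^ u) `^ (2%:R - w).
  by rewrite -powRrM mulVf ?powRr1 ?(le_trans _ C_ge1) // gt_eqF // subr_gt0.
by rewrite gt0_ltr_powR ?subr_gt0 // nnegrE ?powR_ge0.
Qed.

Lemma mm_exponent_near (eps : R) : 0 < eps ->
  exists2 w, mm_exponent w & w < omega R + eps.
Proof.
move=> eps_gt0; apply: inf_adherent => //; split.
  by exists 3%:R; apply: mm_exponent3.
by exists 2%:R; apply: mm_exponent_ge2.
Qed.

End Exponent.

(** * Symbolic execution over polynomials in two variables *)

Section SymbolicRun.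
Variables (R : realType) (I : Type).
Local Notation poly2 := {poly {poly R}}.

Definition sym_operand (inp : I -> poly2) (mu : nat -> poly2)
    (x : operand R I) : poly2 :=
  match x with
  | Inp i => inp i
  | Mem a => mu a
  | Cst c => c%:P%:P
  end.

Definition sym_op (o : ring_op) (x y : poly2) : poly2 :=
  match o with
  | Add => x + y
  | Sub => x - y
  | Mul => x * y
  end.

Definition sym_step inp (mu : nat -> poly2) (c : instr R I) : nat -> poly2 :=
  fun a => if a == target c
           then sym_op (oper c) (sym_operand inp mu (lhs c))
                                (sym_operand inp mu (rhs c))
           else mu a.

Definition horner2 (a b : R) (p : poly2) : R := p.[b%:P].[a].

Lemma horner2_operand inp mu x a b :
  horner2 a b (sym_operand inp mu x) =
  eval_operand (horner2 a b \o inp) (horner2 a b \o mu) x.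
Proof. by case: x => //= c; rewrite /horner2 !hornerC. Qed.

(** Evaluation of polynomials is a ring morphism and straight-line code has no branches, so
    evaluation commutes with execution. *)
Lemma horner2_exec inp mu s x a b :
  horner2 a b (sym_operand inp (foldl (sym_step inp) mu s) x) =
  eval_operand (horner2 a b \o inp)
    (exec (horner2 a b \o inp) (horner2 a b \o mu) s) x.
Proof.
elim: s mu => [|c s IHs] mu /=; first exact: horner2_operand.
rewrite IHs; congr eval_operand; congr foldl.
apply/funext => e; rewrite /step /= /sym_step; case: eqP => // _.
rewrite -!horner2_operand /horner2.
by case: (oper c); rewrite /= ?hornerD ?hornerN ?hornerM ?hornerD ?hornerN.
Qed.

Lemma coef1M (S : nzSemiRingType) (p q : {poly S}) :
  (p * q)`_1 = p`_0 * q`_1 + p`_1 * q`_0.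
Proof. by rewrite coefM big_ord_recl big_ord1. Qed.

Lemma poly_eq0_of_roots (S : idomainType) (e : nat -> S) (p : {poly S}) :
  injective e -> (forall k, p.[e k] = 0) -> p = 0.
Proof.
move=> e_inj pe0; apply/eqP/negPn/negP => p_neq0.
suff : (size [seq e k | k <- iota 0 (size p)] < size p)%N.
  by rewrite size_map size_iota ltnn.
apply: max_poly_roots => //; last by rewrite map_inj_uniq ?iota_uniq.
by apply/allP => _ /mapP[k _ ->]; apply/rootP.
Qed.

(** A polynomial over a domain of characteristic 0 that vanishes at all natural numbers is zero;
    this is applied once for each variable. *)
Lemma horner2_inj (p q : poly2) :
  (forall a b, horner2 a b p = horner2 a b q) -> p = q.
Proof.
have natr_inj : injective (fun k => k%:R : R).
  by move=> k l /eqP; rewrite eqr_nat => /eqP.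
move=> pq; apply/eqP; rewrite -subr_eq0; apply/eqP.
apply: (poly_eq0_of_roots (e := fun k => k%:R%:P)) => [k l|k].
  by move/polyC_inj/natr_inj.
apply: (poly_eq0_of_roots natr_inj) => l.
by rewrite !hornerE -/(horner2 _ _ p) -/(horner2 _ _ q) pq subrr.
Qed.

End SymbolicRun.

(** * Extraction of a bilinear algorithm from a program *)

Section BilinearRank.
Variables (R : realType) (n : nat).
Implicit Types (A B F G : 'M[R]_n) (L : seq ('M[R]_n * 'M[R]_n)).
Implicit Types (s : seq (instr R (mm_index n))).

Definition form F A : R := \sum_(ij : 'I_n * 'I_n) F ij.1 ij.2 * A ij.1 ij.2.

Lemma formDZ c F G A : form (c *: F + G) A = c * form F A + form G A.
Proof.
rewrite /form mulr_sumr -big_split; apply: eq_bigr => ij _.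
by rewrite !mxE mulrDl mulrA.
Qed.

Lemma form0 A : form 0 A = 0.
Proof. by apply: big1 => ij _; rewrite mxE mul0r. Qed.

Lemma form_delta i j A : form (delta_mx i j) A = A i j.
Proof.
rewrite /form (bigD1 (i, j)) //= mxE !eqxx mul1r big1 ?addr0 // => -[k l] /=.
by rewrite mxE xpair_eqE => /negbTE ->; rewrite mul0r.
Qed.

(** A bilinear algorithm: the products of forms listed in [L] are to be shared by all outputs, only
    the weights [w] depending on the output. *)
Definition bilinear_sum L (w : nat -> R) A B : R :=
  \sum_(p < size L)
     w p * (form (nth (0, 0) L p).1 A * form (nth (0, 0) L p).2 B).

Lemma bilinear_sum_cons FG L w A B :
  bilinear_sum (FG :: L) w A B =
  w 0%N * (form FG.1 A * form FG.2 B) + bilinear_sum L (w \o S) A B.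
Proof. by rewrite /bilinear_sum big_ord_recl. Qed.

Lemma bilinear_sumDZ L c w1 w2 A B :
  bilinear_sum L (fun p => c * w1 p + w2 p) A B =
  c * bilinear_sum L w1 A B + bilinear_sum L w2 A B.
Proof.
rewrite /bilinear_sum mulr_sumr -big_split; apply: eq_bigr => p _.
by rewrite mulrDl -mulrA.
Qed.

Lemma bilinear_sum0 L A B : bilinear_sum L (fun=> 0) A B = 0.
Proof. by apply: big1 => p _; rewrite mul0r. Qed.

(* The inner variable scales A and the outer one scales B, so that the
   coefficient [p`_1`_1] is the part of p bilinear in A and B. *)
Definition sym_input A B (ij : mm_index n) : {poly {poly R}} :=
  match ij with
  | inl (i, j) => ((A i j)%:P * 'X)%:P
  | inr (i, j) => (B i j)%:P%:P * 'X
  end.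

(** Only coefficients of degree at most 1 in each variable are tracked: those of a sum or a product
    depend on no others. *)
Definition low_part L c F G w A B (p : {poly {poly R}}) : Prop :=
  [/\ p`_0`_0 = c, p`_0`_1 = form F A, p`_1`_0 = form G B
    & p`_1`_1 = bilinear_sum L w A B].

Definition tame L (h : 'M[R]_n -> 'M[R]_n -> {poly {poly R}}) : Prop :=
  exists c F G w, forall A B, low_part L c F G w A B (h A B).

Lemma tame_cons FG L h : tame L h -> tame (FG :: L) h.
Proof.
case=> c [F [G [w hP]]].
exists c, F, G, (fun p => if p is p'.+1 then w p' else 0) => A B.
have [? ? ? h11] := hP A B.
by split=> //; rewrite bilinear_sum_cons mul0r add0r.
Qed.

Lemma tame_linear L c h1 h2 : tame L h1 -> tame L h2 ->
  tame L (fun A B => c%:P%:P * h1 A B + h2 A B).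
Proof.
case=> c1 [F1 [G1 [w1 h1P]]] [c2 [F2 [G2 [w2 h2P]]]].
exists (c * c1 + c2), (c *: F1 + F2), (c *: G1 + G2).
exists (fun p => c * w1 p + w2 p).
move=> A B; have [a1 b1 d1 e1] := h1P A B; have [a2 b2 d2 e2] := h2P A B.
split; rewrite !(coefD, coefCM) ?formDZ ?bilinear_sumDZ.
- by rewrite a1 a2.
- by rewrite b1 b2.
- by rewrite d1 d2.
- by rewrite e1 e2.
Qed.

(** Besides multiples of the old bilinear parts, the bilinear part of a product contains the cross
    terms [form F1 A * form G2 B] and [form F2 A * form G1 B], which are the two new pairs. *)
Lemma tame_mul L h1 h2 : tame L h1 -> tame L h2 ->
  exists FG1 FG2, tame [:: FG1, FG2 & L] (fun A B => h1 A B * h2 A B).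
Proof.
case=> c1 [F1 [G1 [w1 h1P]]] [c2 [F2 [G2 [w2 h2P]]]].
(* The summands 0 give each combination the shape [c *: F + G] expected by [formDZ]. *)
exists (F1, G2), (F2, G1), (c1 * c2), (c1 *: F2 + (c2 *: F1 + 0)).
exists (c1 *: G2 + (c2 *: G1 + 0)).
exists (fun p => if p is p'.+2 then c1 * w2 p' + (c2 * w1 p' + 0) else 1).
move=> A B; have [a1 b1 d1 e1] := h1P A B; have [a2 b2 d2 e2] := h2P A B.
split; rewrite ?bilinear_sum_cons /= ?formDZ ?form0.
- by rewrite !coef0M a1 a2.
- by rewrite coef0M coef1M a1 a2 b1 b2; ring.
- by rewrite coef1M coefD !coef0M a1 a2 d1 d2; ring.
rewrite coef1M coefD !coef1M a1 a2 b1 b2 d1 d2 e1 e2.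
rewrite [bilinear_sum _ (_ \o _) _ _](_ : _ = c1 * bilinear_sum L w2 A B +
  (c2 * bilinear_sum L w1 A B + bilinear_sum L (fun=> 0) A B)); last first.
  by rewrite -!bilinear_sumDZ.
by rewrite bilinear_sum0; ring.
Qed.

Lemma tame_const L c : tame L (fun _ _ => c%:P%:P).
Proof.
exists c, 0, 0, (fun=> 0) => A B.
by split; rewrite ?form0 ?bilinear_sum0 !coefC.
Qed.

Lemma tame_input L ij : tame L (fun A B => sym_input A B ij).
Proof.
case: ij => [] [i j]; exists 0.
  exists (delta_mx i j), 0, (fun=> 0) => A B.
  by split; rewrite ?form0 ?form_delta ?bilinear_sum0 !coefC /=
    ?coefCM ?coefX ?coef0 ?mulr1 ?mulr0.
exists 0, (delta_mx i j), (fun=> 0) => A B.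
by split; rewrite ?form0 ?form_delta ?bilinear_sum0 coefCM coefX /=
  ?mulr1 ?mulr0 ?coef0 ?coefC.
Qed.

(** Only multiplications enlarge the list, each by two pairs. *)
Lemma tame_exec L s (mem : 'M[R]_n -> 'M[R]_n -> nat -> {poly {poly R}}) :
  (forall a, tame L (fun A B => mem A B a)) ->
  exists2 L', (size L' <= size L + (size s).*2)%N &
    forall a, tame L' (fun A B =>
      foldl (sym_step (sym_input A B)) (mem A B) s a).
Proof.
elim: s L mem => [|i s IHs] L mem memL /=; first by exists L; rewrite ?addn0.
have opL x : tame L (fun A B => sym_operand (sym_input A B) (mem A B) x).
  case: x => [ij|a|c] /=; [exact: tame_input|exact: memL|exact: tame_const].
suff [L1 sizeL1 memL1] : exists2 L1, (size L1 <= (size L).+2)%N &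
    forall a, tame L1 (fun A B => sym_step (sym_input A B) (mem A B) i a).
  have [L2 sizeL2 memL2] := IHs L1 _ memL1; exists L2 => //.
  by rewrite (leq_trans sizeL2) // -addSnnS -addSnnS leq_add2r.
rewrite /sym_step; case: (oper i) => /=.
- exists L; first by rewrite !leqW.
  move=> a; case: eqP => // _.
  have := tame_linear 1 (opL (lhs i)) (opL (rhs i)).
  by under eq_fun2 do rewrite !polyC1 mul1r.
- exists L; first by rewrite !leqW.
  move=> a; case: eqP => // _.
  have := tame_linear (-1) (opL (rhs i)) (opL (lhs i)).
  by under eq_fun2 do rewrite !polyCN !polyC1 mulN1r addrC.
- have [FG1 [FG2 L1P]] := tame_mul (opL (lhs i)) (opL (rhs i)).
  exists [:: FG1, FG2 & L] => // a; case: eqP => // _.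
  by do 2!apply: tame_cons.
Qed.

(* Strassen: dropping all but the bilinear part of a program turns each of its
   multiplications into two products of a form in A with a form in B. *)
Lemma bilinear_decomposition s out : computes_mm s out ->
  exists2 L, (size L <= (size s).*2)%N &
    exists w : 'I_n -> 'I_n -> nat -> R, forall A B i j,
      (A *m B) i j = bilinear_sum L (w i j) A B.
Proof.
move=> sP.
have [|L sizeL LP] := @tame_exec [::] s (fun _ _ _ => 0).
  by move=> a; have := tame_const [::] 0; rewrite !polyC0.
exists L => //.
have outL i j : exists w, forall A B, (A *m B) i j = bilinear_sum L w A B.
  have : tame L (fun A B => sym_operand (sym_input A B)
      (foldl (sym_step (sym_input A B)) (fun=> 0) s) (out i j)).
    case: (out i j) => [ij|a|c];
      [exact: tame_input|exact: LP|exact: tame_const].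
  case=> c [F [G [w wP]]]; exists w => A B; have [_ _ _ <-] := wP A B.
  (* On the inputs a A and b B the program outputs a b (A B)_ij, for all a and b; hence the symbolic
     output is this entry times the product of the two variables. *)
  rewrite (_ : sym_operand _ _ _ = (((A *m B) i j)%:P * 'X)%:P * 'X).
    by rewrite coefMX /= coefC /= coefMX /= coefC.
  apply: horner2_inj => a b; rewrite horner2_exec.
  have -> : horner2 a b \o sym_input A B = mm_input (a *: A) (b *: B).
    apply/funext => -[] [k l] /=; rewrite /horner2 !hornerE !mxE;
      by rewrite mulrC.
  rewrite sP /horner2 !hornerE /= -scalemxAl -scalemxAr scalerA mxE.
  ring.
have /(fin_all_exists (P := fun ij w => forall A B,
    (A *m B) ij.1 ij.2 = bilinear_sum L w A B))[w wP] :
    forall ij : 'I_n * 'I_n, exists w, forall A B,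
    (A *m B) ij.1 ij.2 = bilinear_sum L w A B by move=> ij.
by exists (fun i j => w (i, j)) => A B i j; apply: (wP (i, j)).
Qed.

End BilinearRank.

(** * Memory layouts and compact numbering of cells *)

Section Cells.
Variable D : finType.

(** A memory layout is a finite type whose summands are the regions, which makes the regions
    disjoint by construction. *)
Definition cell (x : D) : nat := enum_rank x.

Lemma cell_lt x : (cell x < #|D|)%N. Proof. exact: ltn_ord. Qed.

Lemma cell_inj : injective cell.
Proof. by move=> x y /val_inj/enum_rank_inj. Qed.

End Cells.

(** Cells of [K] are numbered by their position; the others are sent beyond [size K] to keep the
    renaming injective. The scratch space of a program is thereby bounded by its length, however
    large its addresses. *)
Lemma compact_cells (K : seq nat) :
  exists2 g : nat -> nat, injective g & forall c, c \in K -> (g c < size K)%N.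
Proof.
exists (fun c => if c \in K then index c K else (size K + c)%N) => [a b|c cK].
  case: ifP => aK; case: ifP => bK.
  - by move/(congr1 (nth 0%N K)); rewrite !nth_index.
  - by move=> ab; move: aK; rewrite -index_mem ab ltnNge leq_addr.
  - by move=> ab; move: bK; rewrite -index_mem -ab ltnNge leq_addr.
  - exact: addnI.
by rewrite cK index_mem.
Qed.

Lemma size_code_cells (R : realType) (I : Type) (s : seq (instr R I)) :
  (size (code_cells s) <= 3 * size s)%N.
Proof.
rewrite mulnC; apply: size_flatten_le => -[a o x y].
by case: x; case: y.
Qed.

(** * Block multiplication with reused memory *)

Section BlockProduct.
Variables (R : realType) (n q t : nat).
Variable e : 'I_n -> 'I_q * 'I_t.
Hypothesis e_inj : injective e.

(** Generic in [T] because both matrix entries and operands get padded. *)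
Definition pad T (z : T) (X : 'I_n -> 'I_n -> T) (u v : 'I_q * 'I_t) : T :=
  if [pick i | e i == u] is Some i then
    if [pick k | e k == v] is Some k then X i k else z
  else z.

Lemma pad_e T z (X : 'I_n -> 'I_n -> T) i j : pad z X (e i) (e j) = X i j.
Proof.
rewrite /pad; case: pickP => [k /eqP/e_inj ->|/(_ i)]; last by rewrite eqxx.
by case: pickP => [l /eqP/e_inj ->|/(_ j)]; last rewrite eqxx.
Qed.

Lemma pad_notin T z (X : 'I_n -> 'I_n -> T) u v :
  u \notin codom e -> pad z X u v = z.
Proof.
rewrite /pad; case: pickP => // k /eqP <-; by rewrite codom_f.
Qed.

Lemma pad_map T T' (h : T -> T') z (X : 'I_n -> 'I_n -> T) u v :
  h (pad z X u v) = pad (h z) (fun i j => h (X i j)) u v.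
Proof. by rewrite /pad; case: pickP => // ?; case: pickP. Qed.

Lemma mulmx_pad (A B : 'M[R]_n) i j :
  \sum_v pad 0 A (e i) v * pad 0 B v (e j) = (A *m B) i j.
Proof.
rewrite (bigID (mem (codom e))) /= addrC big1 ?add0r => [|v vNe]; last first.
  by rewrite [X in _ * X]pad_notin ?mulr0.
rewrite mxE (eq_bigl (mem (e @: setT))) => [|v]; last first.
  by apply/codomP/imsetP => [[k ->]|[k _ ->]]; exists k; rewrite ?inE.
rewrite big_imset; last by move=> k l _ _ /e_inj.
by apply: eq_big => [k|k _]; [exact: in_setT|rewrite !pad_e].
Qed.

(** The position (x, z) inside the t x t blocks is fixed and the block varies, so that
    [form F (block A x z)] is the (x, z) entry of the combination of all blocks with coefficients
    F. *)
Definition block (A : 'M[R]_n) (x z : 'I_t) : 'M[R]_q :=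
  \matrix_(a, b) pad 0 A (a, x) (b, z).

Variables (L : seq ('M[R]_q * 'M[R]_q)) (w : 'I_q -> 'I_q -> nat -> R).
Hypothesis Lw : forall A B i j, (A *m B) i j = bilinear_sum L (w i j) A B.
Variables (s : seq (instr R (mm_index t))).
Variable out : 'I_t -> 'I_t -> operand R (mm_index t).
Hypothesis s_out : computes_mm s out.
Variable ren : nat -> nat.
Hypothesis ren_inj : injective ren.

Let D : finType :=
  ((unit + 'I_n * 'I_n) + ('I_t * 'I_t + 'I_t * 'I_t))%type.
Let tmp : nat := cell (inl (inl tt) : D).
Let prod_cell (ij : 'I_n * 'I_n) : nat := cell (inl (inr ij) : D).
Let left_cell (xz : 'I_t * 'I_t) : nat := cell (inr (inl xz) : D).
Let right_cell (zy : 'I_t * 'I_t) : nat := cell (inr (inr zy) : D).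
Let scratch (a : nat) : nat := (#|D| + ren a)%N.

Let combine (target : 'I_t * 'I_t -> nat) (F : 'M[R]_q)
    (X : 'I_n -> 'I_n -> mm_index n) : seq (instr R (mm_index n)) :=
  dots_code false tmp target
    (fun xz => [seq (Cst (F ab.1 ab.2),
                     pad (Cst 0) (fun i k => Inp (X i k))
                       (ab.1, xz.1) (ab.2, xz.2))
               | ab <- enum {: 'I_q * 'I_q}])
    (enum {: 'I_t * 'I_t}).

Let half_cell (ij : mm_index t) : operand R (mm_index n) :=
  match ij with
  | inl xz => Mem (left_cell xz)
  | inr zy => Mem (right_cell zy)
  end.

Let add_products (p : nat) : seq (instr R (mm_index n)) :=
  dots_code true tmp prod_cell
    (fun ij => [:: (Cst (w (e ij.1).1 (e ij.2).1 p),
                    translate_operand half_cell scratch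
                      (out (e ij.1).2 (e ij.2).2))])
    (enum {: 'I_n * 'I_n}).

(** All rounds share the same cells, so the space does not grow with the number of pairs. What
    earlier rounds leave behind is harmless, as [s] is correct from any initial memory. *)
Let round p : seq (instr R (mm_index n)) :=
  combine left_cell (nth (0, 0) L p).1 (fun i k => inl (i, k)) ++
  combine right_cell (nth (0, 0) L p).2 (fun i k => inr (i, k)) ++
  translate half_cell scratch s ++ add_products p.

Definition block_code : seq (instr R (mm_index n)) :=
  dots_code false tmp prod_cell (fun=> [::]) (enum {: 'I_n * 'I_n}) ++
  flatten [seq round p | p <- iota 0 (size L)].

Definition block_out (i j : 'I_n) : operand R (mm_index n) :=
  Mem (prod_cell (i, j)).

Let cell_eq (x y : D) : (cell x == cell y) = (x == y).
Proof. exact: (inj_eq (@cell_inj D)). Qed.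

Let scratch_neq a (x : D) : (scratch a == cell x) = false.
Proof. by rewrite gtn_eqF // (leq_trans (cell_lt x)) ?leq_addr. Qed.

Let dots_writes_cell (J : finType) (h : J -> D) (x : D) :
  cell x != tmp -> (forall j, h j != x) ->
  cell x \notin dots_writes tmp (fun j => cell (h j)).
Proof.
rewrite inE /= => /negbTE -> hx; apply/codomP => -[j /cell_inj xhj].
by have := hx j; rewrite xhj eqxx.
Qed.

Let combine_avoids (h : 'I_t * 'I_t -> D) (F : 'M[R]_q)
    (X : 'I_n -> 'I_n -> mm_index n) xz :
  all (avoids2 (dots_writes tmp (fun xz => cell (h xz))))
    [seq (Cst (F ab.1 ab.2), pad (Cst 0) (fun i k => Inp (X i k))
         (ab.1, xz.1) (ab.2, xz.2)) | ab <- enum {: 'I_q * 'I_q}].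
Proof.
rewrite all_map; apply/allP => ab _ /=.
by rewrite /avoids2 /avoids /= /pad; case: pickP => // ?; case: pickP.
Qed.

Let exec_combine_other (h : 'I_t * 'I_t -> D) F X inp mu c :
  (forall xz, h xz != inl (inl tt)) ->
  c \notin dots_writes tmp (fun xz => cell (h xz)) ->
  exec inp mu (combine (fun xz => cell (h xz)) F X) c = mu c.
Proof.
by move=> ht cW; rewrite exec_dots_code_other // => xz; rewrite cell_eq.
Qed.

Let exec_combine (h : 'I_t * 'I_t -> D) F X (M : 'M[R]_n) inp mu xz :
  injective h -> (forall xz, h xz != inl (inl tt)) ->
  (forall i k, inp (X i k) = M i k) ->
  exec inp mu (combine (fun xz => cell (h xz)) F X) (cell (h xz)) =
  form F (block M xz.1 xz.2).
Proof.
move=> h_inj ht XM.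
rewrite exec_dots_code ?enum_uniq // => [|x y /cell_inj/h_inj //|x].
  rewrite mem_enum inE add0r big_map big_enum; apply: eq_bigr => ab _ /=.
  rewrite mxE (pad_map (eval_operand inp mu)); congr (_ * pad _ _ _ _).
  by apply/funext=> i; apply/funext=> k; apply: XM.
by rewrite cell_eq.
Qed.

Let exec_round A B mu p ij :
  exec (mm_input A B) mu (round p) (prod_cell ij) =
  mu (prod_cell ij) + w (e ij.1).1 (e ij.2).1 p *
    \sum_z form (nth (0, 0) L p).1 (block A (e ij.1).2 z) *
           form (nth (0, 0) L p).2 (block B z (e ij.2).2).
Proof.
set F := (nth _ _ _).1; set G := (nth _ _ _).2; set inp := mm_input A B.
rewrite /round !foldl_cat -/F -/G.
set mu1 := exec inp mu _; set mu2 := exec inp mu1 _; set mu3 := exec inp mu2 _.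
have mu1o c : c \notin dots_writes tmp left_cell -> mu1 c = mu c.
  by apply: exec_combine_other.
have mu2o c : c \notin dots_writes tmp right_cell -> mu2 c = mu1 c.
  by apply: exec_combine_other.
have mu2l xz : mu2 (left_cell xz) = form F (block A xz.1 xz.2).
  rewrite mu2o; last by apply: dots_writes_cell; rewrite ?cell_eq.
  by apply: exec_combine => // ? ? [].
have mu2r zy : mu2 (right_cell zy) = form G (block B zy.1 zy.2).
  by apply: exec_combine => // ? ? [].
have mu2p : mu2 (prod_cell ij) = mu (prod_cell ij).
  by rewrite mu2o ?mu1o //; apply: dots_writes_cell; rewrite ?cell_eq.
have half_avoids ab a : scratch a \notin operand_cells (half_cell ab).
  by case: ab => ?; rewrite /= inE scratch_neq.
rewrite exec_dots_code ?enum_uniq // => [|k l /cell_inj [] //|k|k].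
- rewrite mem_enum inE big_seq1 /=; congr (_ + _ * _).
    by rewrite /mu3 exec_translate_other // => a; rewrite scratch_neq.
  rewrite /mu3 exec_translate // => [|a b /addnI/ren_inj //].
  have -> : (fun i => eval_operand inp mu2 (half_cell i)) =
      mm_input (\matrix_(x, z) form F (block A x z))
               (\matrix_(z, y) form G (block B z y)).
    by apply/funext => -[] [x z] /=; rewrite !mxE ?mu2l ?mu2r.
  by rewrite /= s_out mxE; apply: eq_bigr => z _; rewrite !mxE.
- by rewrite cell_eq.
rewrite /= /avoids2 andbT /avoids /=.
case: (out _ _) => [[] xz|a|//] /=; rewrite andbT.
- by apply: dots_writes_cell; rewrite ?cell_eq.
- by apply: dots_writes_cell; rewrite ?cell_eq.
apply/norP; split; first by rewrite [_ == _]scratch_neq.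
by apply/codomP => -[? /eqP]; rewrite scratch_neq.
Qed.

(** After the sums over p and z are exchanged, each z contributes the identity [Lw] for the real q x
    q matrices [block A x z] and [block B z y]; summing over z gives the padded product. *)
Lemma computes_mm_block : computes_mm block_code block_out.
Proof.
move=> A B mu i j /=; rewrite /block_code foldl_cat.
set mu0 := exec _ mu _; set inp := mm_input A B.
have mu0E : mu0 (prod_cell (i, j)) = 0.
  rewrite /mu0 exec_dots_code ?enum_uniq // => [|k l /cell_inj [] //|k].
    by rewrite mem_enum inE big_nil addr0.
  by rewrite cell_eq.
have -> k : exec inp mu0 (flatten [seq round p | p <- iota 0 k])
      (prod_cell (i, j)) =
    \sum_(p < k) w (e i).1 (e j).1 p *
      \sum_z form (nth (0, 0) L p).1 (block A (e i).2 z) *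
             form (nth (0, 0) L p).2 (block B z (e j).2).
  elim: k => [|k IHk]; first by rewrite big_ord0.
  rewrite -addn1 iotaD map_cat flatten_cat foldl_cat /= cats0 add0n.
  by rewrite exec_round IHk addn1 big_ord_recr.
under eq_bigr do rewrite mulr_sumr.
rewrite exchange_big /= -mulmx_pad.
transitivity (\sum_z (block A (e i).2 z *m block B z (e j).2) (e i).1 (e j).1).
  by apply: eq_bigr => z _; rewrite Lw.
under eq_bigr do rewrite mxE.
rewrite exchange_big pair_big /=; apply: eq_bigr => -[b z] _ /=.
by rewrite !mxE -!surjective_pairing.
Qed.

Lemma size_block_code :
  (size block_code <= n * n + size L *
     (2 * (t * t * (q * q).*2.+1) + size s + 3 * (n * n)))%N.
Proof.
rewrite size_cat; apply: leq_add.
  have /= := @size_dots_code R (mm_index n) _ false tmp prod_cell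
    (fun=> [::]) 0 (enum {: 'I_n * 'I_n}) (fun=> isT).
  by rewrite -cardE card_prod card_ord muln1.
rewrite -[X in (_ <= X * _)%N](size_iota 0); apply: size_flatten_le => p.
have szC h F X : (size (combine h F X) <= t * t * (q * q).*2.+1)%N.
  rewrite -[X in (_ <= X * X * _)%N]card_ord -card_prod cardE.
  apply: size_dots_code => xz.
  by rewrite size_map -cardE card_prod card_ord.
have szP : (size (add_products p) <= n * n * 3)%N.
  rewrite -[X in (_ <= X * X * _)%N]card_ord -card_prod cardE.
  by apply: (@size_dots_code _ _ _ _ _ _ _ 1).
by rewrite !size_cat size_map mul2n -addnn -!addnA !leq_add // mulnC.
Qed.

Lemma within_block_code N :
  (forall c, c \in code_cells s -> ren c < N)%N ->
  within (1 + n * n + 2 * (t * t) + N)%N block_code /\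
  forall i j, all (ltn^~ (1 + n * n + 2 * (t * t) + N)%N)
                  (operand_cells (block_out i j)).
Proof.
move=> renN; set M := (_ + N)%N.
have M_E : M = (#|D| + N)%N.
  by rewrite /M !card_sum !card_prod card_unit !card_ord mul2n -addnn.
have cellM (x : D) : (cell x < M)%N.
  by rewrite M_E (leq_trans (cell_lt x)) ?leq_addr.
have tmpM : (tmp < M)%N by exact: cellM.
have prodM ij : (prod_cell ij < M)%N by exact: cellM.
have scratchM c : c \in code_cells s -> (scratch c < M)%N.
  by move=> /renN; rewrite M_E ltn_add2l.
have combineM h F X : (forall xz, h xz < M)%N -> within M (combine h F X).
  move=> hM; apply: within_dots_code => // xz.
  rewrite all_map; apply/allP => ab _ /=.
  by rewrite /pad; case: pickP => // ?; case: pickP.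
split=> [|i j]; last by rewrite /= cellM.
rewrite within_cat within_dots_code //=; apply: within_flatten => p.
rewrite !within_cat; apply/and4P; split.
- by apply: combineM => xz; apply: cellM.
- by apply: combineM => xz; apply: cellM.
- by apply: within_translate => // -[] ?; rewrite /= andbT; apply: cellM.
apply: within_dots_code => // ij /=; rewrite andbT.
(* The outputs of [s] lie in cells that [s] writes, to which the bound on [ren] applies. *)
have [a [_ aP a_s]] := mm_outputs s_out; rewrite aP /= andbT scratchM //.
exact/target_code_cells/a_s.
Qed.

End BlockProduct.

(** * Multiplication in O(n^w) operations and O(n^2) cells *)

Section LowSpaceProduct.
Variable R : realType.

(* The factorization [q * t ~ n] that balances the two costs of the block
   product: its scratch space [t `^ w] is then about [n ^+ 2], while the linear
   combinations of blocks cost [q `^ w * n ^+ 2], which is about [n `^ w]. *)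
Lemma balanced_factors (w : R) (n : nat) : 2%:R <= w -> (0 < n)%N ->
  exists q t : nat,
    [/\ (0 < q)%N, (0 < t)%N, (n <= q * t)%N & (q * t <= 4 * n)%N] /\
    (q%:R `^ w <= 2%:R `^ w * n%:R `^ (w - 2%:R) /\
     t%:R `^ w <= 2%:R `^ w * n%:R ^+ 2).
Proof.
move=> w_ge2 n_gt0; have w_gt0 : 0 < w by apply: lt_le_trans w_ge2.
have n_ge1 : 1 <= n%:R :> R by rewrite ler1n.
(* The exact real solution: x y = n, x^w = n^(w - 2) and y^w = n^2. Both are at least 1, so rounding
   up at most doubles them; hence the constants 4 and 2^w. *)
pose x : R := n%:R `^ (1 - 2%:R / w); pose y : R := n%:R `^ (2%:R / w).
have xy : x * y = n%:R.
  by rewrite /x /y -powRD ?subrK ?powRr1 // pnatr_eq0 -lt0n n_gt0 implybT.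
have powR_ge1 (r : R) : 0 <= r -> 1 <= n%:R `^ r.
  by move=> r_ge0; rewrite -[leLHS](powRr0 n%:R) ler_powR.
have x_ge1 : 1 <= x by rewrite powR_ge1 // subr_ge0 ler_pdivrMr ?mul1r.
have y_ge1 : 1 <= y by rewrite powR_ge1 // divr_ge0 // ltW.
have xw : x `^ w = n%:R `^ (w - 2%:R).
  by rewrite -powRrM mulrBl mul1r divfK // gt_eqF.
have yw : y `^ w = n%:R ^+ 2 by rewrite -powRrM divfK ?gt_eqF // powR_mulrn.
have roundP (z : R) : 1 <= z ->
    z <= (Num.truncn z).+1%:R /\ (Num.truncn z).+1%:R <= 2%:R * z.
  move=> z_ge1; split; first by rewrite ltW ?truncnS_gt.
  rewrite -addn1 natrD mulr_natl mulr2n lerD // ?z_ge1 // truncn_le //.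
  by rewrite (le_trans ler01).
have powP (z : R) k : 1 <= z -> k%:R <= 2%:R * z ->
    k%:R `^ w <= 2%:R `^ w * z `^ w.
  move=> z_ge1 kz; have z_ge0 : 0 <= z by rewrite (le_trans ler01).
  rewrite -powRM //; apply: ge0_ler_powR => //; rewrite ?nnegrE ?mulr_ge0 //.
  exact: ltW.
exists (Num.truncn x).+1, (Num.truncn y).+1.
have [qx xq] := roundP x x_ge1; have [ty yt] := roundP y y_ge1.
split; [split=> //|split].
- by rewrite -(ler_nat R) natrM -xy ler_pM // (le_trans ler01).
- rewrite -(ler_nat R) !natrM -xy.
  have -> : 4%:R * (x * y) = (2%:R * x) * (2%:R * y) by ring.
  by rewrite ler_pM.
- by rewrite -xw powP.
- by rewrite -yw powP.
Qed.

(** There are O(q^w) = O(n^(w - 2)) rounds, each of cost O((q t)^2 + t^w + n^2) = O(n^2). *)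
Lemma low_space_mm (w : R) : mm_exponent w -> 2%:R <= w ->
  exists C : R, 0 <= C /\ forall n, (0 < n)%N ->
    exists (s : seq (instr R (mm_index n))) out N,
      [/\ computes_mm s out, within N s,
          forall i j, all (ltn^~ N) (operand_cells (out i j)),
          (size s)%:R <= C * n%:R `^ w & N%:R <= C * n%:R ^+ 2].
Proof.
case=> C wC w_ge2.
have C_ge0 : 0 <= C.
  by have [s [out [_]]] := wC 1%N isT; rewrite powR1 mulr1; apply: le_trans.
pose P : R := C * 2%:R `^ w; have P_ge0 : 0 <= P by rewrite mulr_ge0 ?powR_ge0.
(* One constant for both bounds: time takes [1 + 2 * P * (99 + P)] with 99 = 6 * 16 + 3, space takes
   [34 + 3 * P] with 34 = 1 + 1 + 2 * 16. The 16 comes from q t <= 4 n. *)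
exists (34 + 2 * P * (99 + P) + 3 * P); split.
  by have := mulr_ge0 P_ge0 P_ge0; lra.
move=> n n_gt0.
have [q [t [[q_gt0 t_gt0 n_le qt_le] [qw tw]]]] := balanced_factors w_ge2 n_gt0.
have [sq [outq [sqP sq_le]]] := wC q q_gt0.
have [st [outt [stP st_le]]] := wC t t_gt0.
have [L L_le [weight Lw]] := bilinear_decomposition sqP.
have [ren ren_inj renP] := compact_cells (code_cells st).
have n_card : (n <= #|{: 'I_q * 'I_t}|)%N by rewrite card_prod !card_ord.
pose e (i : 'I_n) : 'I_q * 'I_t := enum_val (widen_ord n_card i).
have e_inj : injective e.
  by move=> i j /enum_val_inj /(congr1 val) /= ij; apply: val_inj.
have [Ns Nout] := within_block_code e L weight stP renP.
set D : R := n%:R ^+ 2; set K : R := n%:R `^ (w - 2%:R).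
rewrite -/D -/K in qw tw.
have D_ge1 : 1 <= D by rewrite expr_ge1 // ler1n.
have {}st_le : (size st)%:R <= P * D.
  by rewrite (le_trans st_le) // /P -mulrA ler_wpM2l.
have qtD : (q * t)%:R ^+ 2 <= 16 * D :> R.
  have -> : 16 * D = (4 * n)%:R ^+ 2 by rewrite natrM /D; ring.
  by rewrite lerXn2r ?nnegrE ?ler_nat.
(* An opaque name keeps [q * t] an atom when casts are distributed over products. *)
have [Q QE] : exists Q, Q = (q * t)%N by exists (q * t)%N.
rewrite -QE in qtD.
have tt_le : (t * t <= q * q * (t * t))%N.
  by rewrite leq_pmull // muln_gt0 q_gt0.
exists (block_code e L weight st outt ren), (block_out R t).
exists (1 + n * n + 2 * (t * t) + size (code_cells st))%N.
split=> //; first exact: (computes_mm_block e_inj Lw stP ren_inj).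
- have {}L_le : (size L)%:R <= 2 * P * K.
    apply: le_trans (_ : (size sq).*2%:R <= _); first by rewrite ler_nat.
    rewrite -mul2n natrM /P -!mulrA ler_wpM2l // (le_trans sq_le) //.
    by rewrite ler_wpM2l.
  have K_ge1 : 1 <= K by rewrite -(powRr0 n%:R) ler_powR ?ler1n // subr_ge0.
  have -> : n%:R `^ w = K * D.
    rewrite /K /D -powR_mulrn // -powRD ?subrK //.
    by rewrite pnatr_eq0 -lt0n n_gt0 implybT.
  apply: le_trans (_ : (n * n + size L *
     (2 * (t * t * (q * q).*2.+1) + size st + 3 * (n * n)))%:R <= _).
    by rewrite ler_nat size_block_code.
  have body_le : (2 * (t * t * (q * q).*2.+1) + size st + 3 * (n * n))%:R
      <= (99 + P) * D.
    apply: le_trans (_ : (6 * Q * Q + size st + 3 * (n * n))%:R <= _).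
      by rewrite ler_nat !leq_add2r -mul2n QE; nia.
    rewrite !natrD !natrM.
    have -> : n%:R * n%:R = D by rewrite /D expr2.
    lra.
  rewrite natrD !natrM; have -> : n%:R * n%:R = D by rewrite /D expr2.
  apply: le_trans (_ : K * D + (2 * P * K) * ((99 + P) * D) <= _).
    apply: lerD; last by rewrite ler_pM.
    by rewrite ler_peMl // (le_trans ler01).
  have -> : K * D + 2 * P * K * ((99 + P) * D) =
      (1 + 2 * P * (99 + P)) * (K * D) by ring.
  apply: ler_wpM2r; last by lra.
  by rewrite mulr_ge0 // (le_trans ler01).
- apply: le_trans (_ : (1 + n * n + 2 * Q * Q + 3 * size st)%:R <= _).
    rewrite ler_nat leq_add ?size_code_cells // leq_add2l QE; nia.
  rewrite !natrD !natrM.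
  have -> : n%:R * n%:R = D by rewrite /D expr2.
  have : 0 <= 2 * P * (99 + P) * D.
    apply: mulr_ge0; last by rewrite (le_trans ler01).
    by have := mulr_ge0 P_ge0 P_ge0; lra.
  lra.
Qed.

End LowSpaceProduct.

(** * The prefix-sum structure: code, correctness, time and space *)

Section SearchStructure.
Variables (R : realType) (m d : nat).
Variables (s : seq (instr R (mm_index d))).
Variable out : 'I_d -> 'I_d -> operand R (mm_index d).
Hypothesis s_out : computes_mm s out.

(* Blocks of d consecutive vectors; only the prefix sums over the first
   1, ..., [nsum] blocks are stored, the sum over all the blocks being positive
   by the promise. There are none when [m <= d]. *)
Definition nsum : nat := m.-1 %/ d.

Let D : finType := (unit + 'I_m * 'I_d + 'I_nsum * ('I_d * 'I_d))%type.
Let tmp : nat := cell (inl (inl tt) : D).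
Let vec_cell (ik : 'I_m * 'I_d) : nat := cell (inl (inr ik) : D).
Let sum_cell (b : 'I_nsum) (kl : 'I_d * 'I_d) : nat := cell (inr (b, kl) : D).
Let base : nat := #|D|.

(** Indices from m on denote zero vectors, which fill up the last block. *)
Definition vec_op I (i : nat) (k : 'I_d) : operand R I :=
  if insub i is Some i' then Mem (vec_cell (i', k)) else Cst 0.

(** Slot c holds the sum over c + 1 blocks; the empty prefix is a constant and takes no memory. *)
Definition prefix_op I (b : nat) (kl : 'I_d * 'I_d) : operand R I :=
  if b is c.+1 then
    if insub c is Some c' then Mem (sum_cell c' kl) else Cst 0
  else Cst 0.

Definition input_op (i : nat) (k : 'I_d) : operand R ('I_m * 'I_d) :=
  if insub i is Some i' then Inp (i', k) else Cst 0.

Definition gram_input (b : nat) (ij : mm_index d) : operand R ('I_m * 'I_d) :=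
  match ij with
  | inl (k, i) => input_op (b * d + i) k
  | inr (i, l) => input_op (b * d + i) l
  end.

Definition add_gram (b : 'I_nsum) : seq (instr R ('I_m * 'I_d)) :=
  translate (gram_input b) (addn base) s ++
  dots_code false tmp (sum_cell b)
    (fun kl => [:: (Cst 1, prefix_op _ b kl);
                   (Cst 1, translate_operand (gram_input b) (addn base)
                             (out kl.1 kl.2))])
    (enum {: 'I_d * 'I_d}).

Definition init_code : seq (instr R ('I_m * 'I_d)) :=
  dots_code false tmp vec_cell (fun ik => [:: (Cst 1, Inp ik)])
    (enum {: 'I_m * 'I_d}) ++
  flatten [seq add_gram b | b <- enum 'I_nsum].

Definition leaf_input (b : nat) (ij : mm_index d) : operand R ('I_d * 'I_d) :=
  match ij with
  | inl kl => Inp kl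
  | inr (k, j) => vec_op _ (b * d + j) k
  end.

(** Scratch cells of a query start at [base.+1] because [base] holds the value under test. *)
Definition product_op (b : nat) (k j : 'I_d) : operand R ('I_d * 'I_d) :=
  translate_operand (leaf_input b) (addn base.+1) (out k j).

Definition test_vector (b : nat) (j : 'I_d) : seq (instr R ('I_d * 'I_d)) :=
  dot_code false tmp base
    [seq (vec_op _ (b * d + j) k, product_op b k j) | k <- enum 'I_d].

(** The default answer 0 is returned only when all tests fail. *)
Definition scan (b : nat) (js : seq 'I_d) : prog R ('I_d * 'I_d) nat :=
  foldr (fun j p => then_run (test_vector b j)
           (IfLt (Cst 0) (Mem base) (Ret (b * d + j)%N) p)) (Ret 0%N) js.

Definition search_block (b : nat) : prog R ('I_d * 'I_d) nat :=
  then_run (translate (leaf_input b) (addn base.+1) s) (scan b (enum 'I_d)).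

Definition test_prefix (b : nat) : seq (instr R ('I_d * 'I_d)) :=
  dot_code false tmp base
    [seq (prefix_op _ b kl, Inp kl) | kl <- enum {: 'I_d * 'I_d}].

(** Bisection of the window from [lo] to [lo + 2 ^ k]. A midpoint beyond [nsum] covers all the
    vectors, so it counts as positive without a test. *)
Fixpoint search (k lo : nat) : prog R ('I_d * 'I_d) nat :=
  if k is k'.+1 then
    if (lo + 2 ^ k' <= nsum)%N then
      then_run (test_prefix (lo + 2 ^ k'))
        (IfLt (Cst 0) (Mem base) (search k' lo) (search k' (lo + 2 ^ k')))
    else search k' lo
  else search_block lo.

Definition prefix_structure : search_structure R m d :=
  SearchStructure (then_run init_code (Ret tt))
                  (search (up_log 2 nsum.+1) 0).

Let cell_eq (x y : D) : (cell x == cell y) = (x == y).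
Proof. exact: (inj_eq (@cell_inj D)). Qed.

Let cell_base (x : D) a : (cell x == base + a)%N = false.
Proof. by rewrite ltn_eqF // (leq_trans (cell_lt x)) ?leq_addr. Qed.

Let base_cell (x : D) a : (base + a == cell x)%N = false.
Proof. by rewrite eq_sym cell_base. Qed.

Let base0_cell (x : D) : (base == cell x) = false.
Proof. by rewrite -[base]addn0 base_cell. Qed.

Let data_avoids I (x : D) :
  x != inl (inl tt) -> avoids (pred2 tmp base) (Mem (cell x) : operand R I).
Proof.
rewrite /avoids /= andbT => xt; apply/norP.
by split; [rewrite cell_eq|rewrite eq_sym base0_cell].
Qed.

Let scratch_avoids I a :
  avoids (pred2 tmp base) (Mem (base.+1 + a)%N : operand R I).
Proof.
rewrite /avoids /= andbT; apply/norP; rewrite addSnnS.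
by split; [rewrite [_ == _]base_cell|rewrite gtn_eqF // -addSnnS leq_addr].
Qed.

Section Correctness.
Variable v : 'I_m -> 'cV[R]_d.

Definition entry (i : nat) (k : 'I_d) : R :=
  if insub i is Some i' then v i' k 0 else 0.

Definition prefix_sum (b : nat) (kl : 'I_d * 'I_d) : R :=
  \sum_(i < b * d) entry i kl.1 * entry i kl.2.

Lemma prefix_sumS b kl : prefix_sum b.+1 kl =
  prefix_sum b kl +
  \sum_(j < d) entry (b * d + j) kl.1 * entry (b * d + j) kl.2.
Proof. by rewrite /prefix_sum mulSnr big_split_ord. Qed.

Definition loaded (n : nat) (mu : memory R) : Prop :=
  (forall ik, mu (vec_cell ik) = v ik.1 ik.2 0) /\
  (forall (b : 'I_nsum) kl, (b < n)%N ->
     mu (sum_cell b kl) = prefix_sum b.+1 kl).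

Lemma eval_vec_op I (inp : I -> R) n mu i k : loaded n mu ->
  eval_operand inp mu (vec_op I i k) = entry i k.
Proof.
by case=> vP _; rewrite /vec_op /entry; case: insubP => //= ? _ _; rewrite vP.
Qed.

Lemma eval_prefix_op I (inp : I -> R) n mu b kl :
  loaded n mu -> (b <= n)%N -> (b <= nsum)%N ->
  eval_operand inp mu (prefix_op I b kl) = prefix_sum b kl.
Proof.
case=> _ sumP; case: b => [|b] bn b_nsum /=.
  by rewrite /prefix_sum big_ord0.
by rewrite (insubT (fun c => c < nsum)%N b_nsum) /= sumP.
Qed.

Lemma eval_input_op mu i k :
  eval_operand (init_input v) mu (input_op i k) = entry i k.
Proof. by rewrite /input_op /entry; case: insubP. Qed.

(** With the vectors of block b as the columns of V, the product V V^T computed by [s] is the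
    increment between two consecutive prefix sums. *)
Lemma loaded_add_gram (b : 'I_nsum) mu : loaded b mu ->
  loaded b.+1 (exec (init_input v) mu (add_gram b)).
Proof.
move=> bP; rewrite /add_gram foldl_cat.
set inp := init_input v; set mu1 := exec inp mu _.
have mu1D x : mu1 (cell (x : D)) = mu (cell x).
  by rewrite /mu1 exec_translate_other // => a; rewrite base_cell.
have b1P : loaded b mu1.
  by split=> [ik|c kl cb]; rewrite mu1D; [apply: bP.1|apply: bP.2].
have gram_cells ij : operand_cells (gram_input b ij) = [::].
  by case: ij => [] [k i]; rewrite /= /input_op; case: insubP.
have gramP kl : eval_operand inp mu1
    (translate_operand (gram_input b) (addn base) (out kl.1 kl.2)) =
    \sum_(j < d) entry (b * d + j) kl.1 * entry (b * d + j) kl.2.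
  rewrite exec_translate => [|? ? /addnI //|ij a]; last by rewrite gram_cells.
  rewrite /= (_ : (fun _ => _) = mm_input (\matrix_(k, i) entry (b * d + i) k)
      (\matrix_(i, l) entry (b * d + i) l)).
    by rewrite s_out mxE; apply: eq_bigr => j _; rewrite !mxE.
  by apply/funext => -[] [k i] /=; rewrite eval_input_op mxE.
have avoid kl : all (avoids2 (dots_writes tmp (sum_cell b)))
    [:: (Cst 1, prefix_op _ b kl);
        (Cst 1, translate_operand (gram_input b) (addn base) (out kl.1 kl.2))].
  rewrite /= /avoids2 /= andbT; apply/andP; split.
    case: b {bP mu1 mu1D b1P gram_cells gramP} => -[//|b] bP /=.
    rewrite /avoids; case: insubP => //= c _ cb; rewrite andbT.
    apply/norP; split; first by rewrite [_ == _]cell_eq.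
    apply/codomP => -[xy /cell_inj [ebc _]].
    by move/eqP: cb; rewrite ebc /= gtn_eqF.
  case: (out _ _) => [ij|a|//]; first by rewrite /avoids gram_cells.
  rewrite /avoids /= andbT; apply/norP.
  split; first by rewrite [_ == _]base_cell.
  by apply/codomP => -[xy /eqP]; rewrite base_cell.
have tmp_neq kl : sum_cell b kl != tmp by rewrite cell_eq.
have other x : (forall kl, x != inr (b, kl)) -> x != inl (inl tt) ->
  cell (x : D) \notin dots_writes tmp (sum_cell b).
  move=> xb xt; apply/norP; split; first by rewrite cell_eq.
  by apply/codomP => -[kl /cell_inj xE]; have := xb kl; rewrite xE eqxx.
split=> [ik|c kl].
  by rewrite exec_dots_code_other // ?other //; apply: b1P.1.
rewrite ltnS leq_eqVlt => /predU1P[/val_inj ->|cb].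
  rewrite exec_dots_code ?enum_uniq // => [|x y /cell_inj[] //].
  rewrite mem_enum inE add0r big_cons big_seq1 /= !mul1r gramP.
  by rewrite (eval_prefix_op _ _ b1P) // ?prefix_sumS // ltnW.
rewrite exec_dots_code_other //; first exact: b1P.2.
by apply: other => // xy; apply/eqP => -[ec _]; move: cb; rewrite ec ltnn.
Qed.

Lemma loaded_init mu : loaded nsum (exec (init_input v) mu init_code).
Proof.
rewrite /init_code foldl_cat; set mu0 := exec _ mu _.
have mu0P : loaded 0 mu0.
  split=> // ik; rewrite /mu0 exec_dots_code ?enum_uniq //.

  - by rewrite mem_enum inE add0r big_seq1 /= mul1r.
  - by move=> x y /cell_inj[].
  - by move=> x; rewrite cell_eq.
(* The induction runs over initial segments of the list of blocks, as each sum is built from the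
   previous one. *)
suff: forall n, (n <= nsum)%N -> loaded n (exec (init_input v) mu0
    (flatten [seq add_gram b | b <- take n (enum 'I_nsum)])).
  by move=> /(_ nsum (leqnn _)); rewrite take_oversize // size_enum_ord.
elim=> [|n IHn] n_nsum; first by rewrite take0.
pose b := Ordinal n_nsum.
rewrite (take_nth b) ?size_enum_ord // (_ : nth b _ n = b); last first.
  by apply: val_inj; rewrite /= nth_enum_ord.
rewrite -cats1 map_cat flatten_cat foldl_cat /= cats0.
exact/(loaded_add_gram (b := b))/IHn/ltnW.
Qed.

Lemma exec_test_vector b j inp mu c : c != tmp ->
  exec inp mu (test_vector b j) c =
  if c == base then \sum_k eval_operand inp mu (vec_op _ (b * d + j) k) *
                           eval_operand inp mu (product_op b k j)
  else mu c.
Proof.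
move=> ctmp; rewrite exec_dot_code ?base0_cell //.
  by rewrite add0r big_map big_enum.
rewrite all_map; apply/allP => k _; apply/andP; split.
  by rewrite /vec_op; case: insubP => // i _ _; apply: data_avoids.
rewrite /product_op; case: (out _ _) => [[kl|[k' j']]|a|c'] //=.
by rewrite /vec_op; case: insubP => // i _ _; apply: data_avoids.
Qed.

Lemma exec_test_prefix b inp mu c : c != tmp ->
  exec inp mu (test_prefix b) c =
  if c == base then \sum_kl eval_operand inp mu (prefix_op _ b kl) * inp kl
  else mu c.
Proof.
move=> ctmp; rewrite exec_dot_code ?base0_cell //.
  by rewrite add0r big_map big_enum.
rewrite all_map; apply/allP => k _; apply/andP; split=> //.
rewrite /prefix_op; case: b => // b; case: insubP => // i _ _.
exact: data_avoids.
Qed.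

(** What every query preserves: only [tmp] and cells from [base] on are overwritten, so the stored
    data survive any number of queries. *)
Definition same_data (mu1 mu2 : memory R) : Prop :=
  forall c, (c < base)%N -> c != tmp -> mu1 c = mu2 c.

Lemma loaded_same_data n mu1 mu2 :
  same_data mu1 mu2 -> loaded n mu2 -> loaded n mu1.
Proof.
move=> mu12 [vP sumP]; split=> [ik|b kl bn].
  by rewrite mu12 ?cell_lt ?cell_eq.
by rewrite mu12 ?cell_lt ?cell_eq // sumP.
Qed.

Lemma same_data_test_vector b j inp mu :
  same_data (exec inp mu (test_vector b j)) mu.
Proof. by move=> c cb ctmp; rewrite exec_test_vector // ltn_eqF. Qed.

Lemma same_data_test_prefix b inp mu :
  same_data (exec inp mu (test_prefix b)) mu.
Proof. by move=> c cb ctmp; rewrite exec_test_prefix // ltn_eqF. Qed.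

Lemma run_scan_cons b j js inp mu :
  run (scan b (j :: js)) inp mu =
  if 0 < exec inp mu (test_vector b j) base
  then ((b * d + j)%N, exec inp mu (test_vector b j))
  else run (scan b js) inp (exec inp mu (test_vector b j)).
Proof. by rewrite /scan /= run_then_run. Qed.

Lemma same_data_scan b js inp mu :
  same_data (final_memory (scan b js) inp mu) mu.
Proof.
elim: js mu => // j js IHjs mu c cb ctmp.
rewrite /final_memory run_scan_cons; case: ifP => _ /=.
  exact: same_data_test_vector.
by rewrite -(same_data_test_vector b j inp mu) //; apply: IHjs.
Qed.

Lemma searchS k lo : search k.+1 lo =
  if (lo + 2 ^ k <= nsum)%N then
    then_run (test_prefix (lo + 2 ^ k))
      (IfLt (Cst 0) (Mem base) (search k lo) (search k (lo + 2 ^ k)))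
  else search k lo.
Proof. by []. Qed.

Lemma run_searchS k lo inp mu :
  run (search k.+1 lo) inp mu =
  if (lo + 2 ^ k <= nsum)%N then
    if 0 < exec inp mu (test_prefix (lo + 2 ^ k)) base
    then run (search k lo) inp (exec inp mu (test_prefix (lo + 2 ^ k)))
    else run (search k (lo + 2 ^ k)) inp
           (exec inp mu (test_prefix (lo + 2 ^ k)))
  else run (search k lo) inp mu.
Proof.
by rewrite searchS; case: ifP => // _; rewrite run_then_run.
Qed.

Lemma same_data_search k lo inp mu :
  same_data (final_memory (search k lo) inp mu) mu.
Proof.
elim: k lo mu => [|k IHk] lo mu c cb ctmp.
  rewrite /search_block /final_memory run_then_run [LHS]same_data_scan //.
  by rewrite exec_translate_other // => a; rewrite gtn_eqF // ltn_addr // ltnW.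
rewrite /final_memory run_searchS; case: ifP => _; last exact: IHk.
rewrite -(same_data_test_prefix (lo + 2 ^ k) inp mu) //.
by case: ifP => _; apply: IHk.
Qed.

Lemma reachable_loaded mu : reachable prefix_structure v mu -> loaded nsum mu.
Proof.
elim=> [mu0|mu0 A _ IH _].
  by rewrite /final_memory run_then_run; apply: loaded_init.
exact: loaded_same_data (same_data_search _ _ _ _) IH.
Qed.

Section Query.
Variable A : 'M[R]_d.

(** The quadratic form v_i^T A v_i, extended by 0 to i >= m. *)
Definition quad (i : nat) : R :=
  \sum_(kl : 'I_d * 'I_d) entry i kl.1 * entry i kl.2 * A kl.1 kl.2.

Lemma quad_mx_inner (i : 'I_m) : quad i = mx_inner (rank_one (v i)) A.
Proof.
rewrite /quad /mx_inner /mxtrace; under [RHS]eq_bigr do rewrite mxE.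
rewrite exchange_big pair_big; apply: eq_bigr => -[k l] _ /=.
by rewrite /entry valK !mxE big_ord1 !mxE.
Qed.

Lemma quad_oversize i : (m <= i)%N -> quad i = 0.
Proof.
by move=> mi; apply: big1 => kl _; rewrite /entry insubF ?mul0r // ltnNge mi.
Qed.

Definition prefix_value (b : nat) : R := \sum_(i < b * d) quad i.

Lemma prefix_valueE b :
  \sum_kl prefix_sum b kl * query_input A kl = prefix_value b.
Proof.
under eq_bigr do rewrite mulr_suml.
by rewrite exchange_big.
Qed.

Lemma prefix_value_oversize b : (m <= b * d)%N ->
  prefix_value b = \sum_(i < m) mx_inner (rank_one (v i)) A.
Proof.
move=> m_le; under [RHS]eq_bigr do rewrite -quad_mx_inner.
rewrite /prefix_value (big_ord_widen _ quad m_le) [RHS]big_mkcond.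
apply: eq_bigr => i _; case: ltnP => // /quad_oversize //.
Qed.

Lemma scanP b (js : seq 'I_d) mu :
  (forall k j : 'I_d, eval_operand (query_input A) mu (product_op b k j) =
     \sum_l A k l * entry (b * d + j)%N l) ->
  loaded nsum mu -> (exists2 j : 'I_d, j \in js & 0 < quad (b * d + j)) ->
  exists j : 'I_d, result (scan b js) (query_input A) mu = (b * d + j)%N /\
    0 < quad (b * d + j).
Proof.
elim: js mu => [|j js IHjs] mu prodP muP; first by case=> j.
move=> ex; rewrite /result run_scan_cons.
rewrite exec_test_vector ?base0_cell // eqxx.
have -> : \sum_k eval_operand (query_input A) mu (vec_op _ (b * d + j) k) *
    eval_operand (query_input A) mu (product_op b k j) = quad (b * d + j).
  rewrite /quad -(pair_big xpredT xpredT
    (fun k l => entry (b * d + j) k * entry (b * d + j) l * A k l)) /=.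
  apply: eq_bigr => k _; rewrite (eval_vec_op _ _ _ muP) prodP mulr_sumr.
  by apply: eq_bigr => l _; rewrite mulrCA mulrC.
case: ifP => [j_gt0|/negbT j_le0]; first by exists j.
apply: IHjs; last first.
- case: ex => i; rewrite inE => /predU1P[->|i_js] i_gt0; last by exists i.
  by rewrite i_gt0 in j_le0.
- exact: loaded_same_data (same_data_test_vector _ _ _ _) muP.
(* The test writes only [tmp] and [base], which no operand of the stored product A V reads, so the
   hypothesis on this product persists. *)
have := exec_test_vector b j (query_input A) mu.
move: (exec _ mu _) => mu' mu'E k i; rewrite -prodP; apply: eq_eval_operand.
rewrite /product_op; case: (out k i) => [[kl|[k' i']]|a|e] //= c.
  rewrite /vec_op; case: insubP => //= i0 _ _; rewrite inE => /eqP ->.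
  by rewrite mu'E ?cell_eq // eq_sym base0_cell.
rewrite inE => /eqP ->; rewrite mu'E addSnnS ?base_cell //.
by rewrite gtn_eqF // -addSnnS leq_addr.
Qed.

(** The signs at both ends of the window are invariant. Once the window is a single block, the sum
    over this block is positive, hence so is one of its terms. *)
Lemma searchP k lo mu : loaded nsum mu ->
  prefix_value lo <= 0 < prefix_value (lo + 2 ^ k) -> promise v A ->
  (0 < d)%N -> (0 < m)%N ->
  exists i : 'I_m, result (search k lo) (query_input A) mu = i /\
    0 < mx_inner (rank_one (v i)) A.
Proof.
move=> + + prom d_gt0 m_gt0.
elim: k lo mu => [|k IHk] lo mu muP /=.
  rewrite addn1 => /andP[lo_le lo_gt].
  have [j j_gt0] : exists j : 'I_d, 0 < quad (lo * d + j).
    apply: contrapT => no_j; move: lo_gt; apply/negP; rewrite -leNgt.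
    rewrite /prefix_value mulSnr big_split_ord /= -[leRHS]addr0 lerD //.
    apply: sumr_le0 => j _; rewrite leNgt; apply/negP => j_gt0.
    by apply: no_j; exists j.
  rewrite /search_block /result run_then_run; set mu' := exec _ mu _.
  have mu'D x : mu' (cell (x : D)) = mu (cell x).
    by rewrite /mu' exec_translate_other // => a; rewrite addSnnS base_cell.
  have mu'P : loaded nsum mu'.
    by split=> [ik|b kl bn]; rewrite mu'D; [apply: muP.1|apply: muP.2].
  have prodP k i : eval_operand (query_input A) mu' (product_op lo k i) =
      \sum_l A k l * entry (lo * d + i) l.
    rewrite exec_translate => [|? ? /addnI //|[kl|[l j']] a] //; last first.
      rewrite /= /vec_op; case: insubP => //= i' _ _.
      by rewrite inE addSnnS base_cell.
    rewrite /= (_ : (fun _ => _) =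
      mm_input A (\matrix_(l, j) entry (lo * d + j) l)).
      by rewrite s_out mxE; apply: eq_bigr => l _; rewrite mxE.
    apply/funext => -[] [l j'] //=.
    by rewrite (eval_vec_op _ _ _ muP) mxE.
  have [|j' [scanE j'_gt0]] := scanP (js := enum 'I_d) prodP mu'P.
    by exists j; rewrite ?mem_enum.
  (* The zero vectors filling the last block have value 0, so the index found is a genuine one. *)
  have i_lt : (lo * d + j' < m)%N.
    rewrite ltnNge; apply/negP => /quad_oversize q0.
    by rewrite q0 ltxx in j'_gt0.
  by exists (Ordinal i_lt); rewrite -quad_mx_inner.
move=> /andP[lo_le hi_gt]; rewrite /result run_searchS; case: ifP => mid_le.
  rewrite exec_test_prefix ?base0_cell // eqxx.
  under eq_bigr do rewrite (eval_prefix_op _ _ muP) //.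
  rewrite prefix_valueE; have mu'P := loaded_same_data
    (same_data_test_prefix (lo + 2 ^ k) (query_input A) mu) muP.
  case: ifP => [mid_gt|/negbT]; first by apply: IHk => //; rewrite lo_le.
  rewrite -leNgt => mid_le0; apply: IHk => //.
  by rewrite mid_le0 -addnA addnn -mul2n -expnS.
(* Here [lo + 2 ^ k] exceeds [nsum], so this prefix contains all m vectors and is positive by the
   promise. *)
apply: IHk => //; rewrite lo_le prefix_value_oversize //.
move/negbT: mid_le; rewrite -ltnNge => mid_gt.
rewrite -(prednK m_gt0) (leq_trans (ltn_ceil m.-1 d_gt0)) // leq_mul2r.
by rewrite mid_gt orbT.
Qed.

Lemma prefix_structureP mu : (0 < m)%N -> (0 < d)%N ->
  reachable prefix_structure v mu -> promise v A ->
  exists i : 'I_m, result (query prefix_structure) (query_input A) mu = i /\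
    0 < mx_inner (rank_one (v i)) A.
Proof.
move=> m_gt0 d_gt0 /reachable_loaded muP prom; apply: searchP => //.
rewrite add0n /prefix_value big_ord0 lexx /=.
rewrite -/(prefix_value _) prefix_value_oversize //.
rewrite -(prednK m_gt0) (leq_trans (ltn_ceil m.-1 d_gt0)) // leq_mul2r.
by rewrite up_logP ?orbT.
Qed.

End Query.
End Correctness.

Lemma size_init_code :
  (size init_code <= m * d * 3 + nsum * (size s + d * d * 5))%N.
Proof.
rewrite size_cat leq_add //.
  rewrite -[X in (_ <= X * _ * _)%N]card_ord -[X in (_ <= _ * X * _)%N]card_ord.
  by rewrite -card_prod cardE; apply: (@size_dots_code _ _ _ _ _ _ _ 1).
rewrite -[X in (_ <= X * _)%N](size_enum_ord nsum); apply: size_flatten_le => b.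
rewrite size_cat size_map leq_add2l.
rewrite -[X in (_ <= X * X * _)%N]card_ord.
by rewrite -card_prod cardE; apply: (@size_dots_code _ _ _ _ _ _ _ 2).
Qed.

Lemma run_time_init inp mu :
  (run_time (init prefix_structure) inp mu <=
     m * d * 3 + nsum * (size s + d * d * 5))%N.
Proof. by rewrite run_time_then_run addn0 size_init_code. Qed.

Lemma run_time_scan b js inp mu :
  (run_time (scan b js) inp mu <= size js * d.*2.+2)%N.
Proof.
elim: js mu => // j js IHjs mu.
have -> : run_time (scan b (j :: js)) inp mu = (size (test_vector b j) +
    (if (0 < exec inp mu (test_vector b j) base)%R then 0
     else run_time (scan b js) inp (exec inp mu (test_vector b j))).+1)%N.
  exact: run_time_then_run.
rewrite size_dot_code size_map size_enum_ord mulSn addnS -addSn leq_add //.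
by case: ifP.
Qed.

Lemma run_time_search k lo inp mu :
  (run_time (search k lo) inp mu <=
     k * (d * d).*2.+2 + (size s + d * d.*2.+2))%N.
Proof.
elim: k lo mu => [|k IHk] lo mu.
  rewrite add0n /search_block run_time_then_run size_map leq_add2l.
  by rewrite -[X in (_ <= X * _)%N](size_enum_ord d) run_time_scan.
rewrite searchS; case: ifP => _; last first.
  by rewrite (leq_trans (IHk _ _)) // leq_add2r leq_mul2r leqnSn orbT.
rewrite run_time_then_run size_dot_code size_map -cardE card_prod card_ord.
rewrite mulSn -[leqRHS]addnA /= addnS -addSn leq_add //.
by case: ifP => _; apply: IHk.
Qed.

Variable N : nat.
Hypothesis s_N : within N s.
Hypothesis out_N : forall i j, all (ltn^~ N) (operand_cells (out i j)).

(** Scratch is charged as [nsum * N] rather than N: for m <= d no sum is stored and no scratch is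
    used, whereas N may be of order d^2 and exceed m d. *)
Lemma space_init inp mu :
  (space_used (init prefix_structure) inp mu <=
     1 + m * d + nsum * (d * d) + nsum * N)%N.
Proof.
apply: space_used_within; set M := (_ + nsum * N)%N.
have M_E : M = (base + nsum * N)%N.
  by rewrite /M /base !card_sum !card_prod card_unit !card_ord.
have cellM (x : D) : (cell x < M)%N.
  by rewrite M_E (leq_trans (cell_lt x)) ?leq_addr.
have tmpM : (tmp < M)%N by exact: cellM.
rewrite within_cat; apply/andP; split.
  by apply: within_dots_code => // ik; apply: cellM.
apply: within_flatten => b.
have scratchM a : (a < N)%N -> (base + a < M)%N.
  (* The block b at hand witnesses that [nsum] is positive, so N <= [nsum * N]. *)
  move=> aN; rewrite M_E ltn_add2l (leq_trans aN) // leq_pmull //.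
  by case: (nsum) b => // -[].
have gram_cells ij : operand_cells (gram_input b ij) = [::].
  by case: ij => [] [k i]; rewrite /= /input_op; case: insubP.
rewrite within_cat; apply/andP; split.
  apply: within_translate => [a as_|ij]; last by rewrite gram_cells.
  exact/scratchM/(allP s_N).
apply: within_dots_code => // kl; first exact: cellM.
rewrite /= andbT; apply/andP; split.
  rewrite /prefix_op; case: (nat_of_ord b) => // c; case: insubP => //= c' _ _.
  by rewrite cellM.
have := out_N kl.1 kl.2; case: (out _ _) => [ij _|a|//].
  by rewrite gram_cells.
by rewrite /= !andbT; apply: scratchM.
Qed.

End SearchStructure.

(** * Number of search steps and final bounds *)

Lemma up_log2_le (R : realType) (b m : nat) : (b <= m)%N -> (0 < m)%N ->
  (up_log 2 b)%:R <= 1 + ln m%:R / ln 2%:R :> R.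
Proof.
move=> b_m m_gt0; have ln2_gt0 : 0 < ln 2%:R :> R by rewrite ln_gt0 ?ltr1n.
have lnm_ge0 : 0 <= ln m%:R :> R by rewrite ln_ge0 ?ler1n.
case: (leqP b 1) => [b_le1|b_gt1].
  have -> : up_log 2 b = 0%N by apply/eqP; rewrite up_log_eq0 b_le1.
  by rewrite addr_ge0 ?divr_ge0 // ltW.
have up_gt0 : (0 < up_log 2 b)%N by rewrite up_log_gt0.
rewrite -(prednK up_gt0) -add1n natrD lerD2l ler_pdivlMr // mulr_natl.
rewrite -lnXn ?ltr0n //.
rewrite ler_ln ?posrE ?exprn_gt0 ?ltr0n // -natrX ler_nat.
by rewrite (leq_trans _ b_m) // ltnW // up_log_gtn.
Qed.

Theorem theorem5p3 (R : realType) (eps : R) (eps_gt0 : 0 < eps) :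
  exists (ds : forall m d : nat, search_structure R m d) (C : R),
  forall (m d : nat), (0 < m)%N -> (0 < d)%N ->
  forall v : 'I_m -> 'cV[R]_d,
  [/\ forall mu : memory R,
        (run_time (init (ds m d)) (init_input v) mu)%:R
          <= C * (m%:R * d%:R `^ (omega R + eps - 1)),
      forall mu : memory R,
        (space_used (init (ds m d)) (init_input v) mu)%:R <= C * (m%:R * d%:R)
    & forall (A : 'M[R]_d) (mu : memory R),
        reachable (ds m d) v mu -> promise v A ->
        (exists i : 'I_m,
           result (query (ds m d)) (query_input A) mu = i
           /\ 0 < mx_inner (rank_one (v i)) A)
        /\ (run_time (query (ds m d)) (query_input A) mu)%:R
             <= C * (d%:R ^+ 2 * ln m%:R + d%:R `^ (omega R + eps))].
Proof.
(* The infimum [omega] may not be attained; the slack [eps] leaves room for an actual exponent w. *)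
have [w w_mm w_lt] := mm_exponent_near eps_gt0.
have w_ge2 := mm_exponent_ge2 w_mm.
set W := omega R + eps in w_lt *.
have [C [C_ge0 mmP]] := low_space_mm w_mm w_ge2.
have ln2_gt0 : 0 < ln 2%:R :> R by rewrite ln_gt0 ?ltr1n.
have codeP d : exists code : seq (instr R (mm_index d)) *
    ('I_d -> 'I_d -> operand R (mm_index d)), (0 < d)%N ->
    exists N, [/\ computes_mm code.1 code.2, within N code.1,
      forall i j, all (ltn^~ N) (operand_cells (code.2 i j)),
      (size code.1)%:R <= C * d%:R `^ w & N%:R <= C * d%:R ^+ 2].
  (* Dimension 0 gets empty code, so that a single choice function covers every d. *)
  case: (posnP d) => [->|/mmP[s [out [N NP]]]]; last first.
    by exists (s, out); exists N.
  by exists ([::], fun _ _ => Cst 0).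
pose code d := projT1 (cid (codeP d)).
(* In the time of Init, C + 8 is 3 for copying the vectors plus C + 5 for the Gram matrices. In that
   of a query it is C for the product plus 4 for the scan and 4 for the rounding of the logarithm,
   while [4 / ln 2] converts the logarithm to base 2. *)
exists (fun m d => prefix_structure m (code d).1 (code d).2), (C + 8 + 4 / ln 2).
move=> m d m_gt0 d_gt0 v.
have [N [sP s_N out_N s_le N_le]] := projT2 (cid (codeP d)) d_gt0.
rewrite -/(code d) in sP s_N out_N s_le.
have d_ge1 : 1 <= d%:R :> R by rewrite ler1n.
have W_ge2 : 2 <= W by rewrite (le_trans w_ge2) // ltW.
have c_ge0 : 0 <= 4 / ln 2 :> R by rewrite divr_ge0 // ltW.
have {}s_le : (size (code d).1)%:R <= C * d%:R `^ W.
  by rewrite (le_trans s_le) // ler_wpM2l // ler_powR // ltW.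
have d2_le : d%:R ^+ 2 <= d%:R `^ W by rewrite -powR_mulrn // ler_powR.
have d_le : d%:R <= d%:R `^ (W - 1).
  by rewrite -[leLHS]powRr1 // ler_powR //; lra.
have dW : d%:R * d%:R `^ (W - 1) = d%:R `^ W.
  by rewrite mulr_powRB1 //; lra.
(* The cost d^W of each stored sum is thus spread over d vectors, which gives m d^(W - 1) in all,
   even when m < d. *)
have nsum_le : (nsum m d)%:R * d%:R <= m%:R :> R.
  by rewrite -natrM ler_nat (leq_trans (leq_trunc_div _ _)) // leq_pred.
have nsum_m : ((nsum m d).+1 <= m)%N.
  by rewrite -[X in (_ <= X)%N](prednK m_gt0) ltnS leq_div.
have m_ge1 : 1 <= m%:R :> R by rewrite ler1n.
split=> [mu|mu|A mu mu_reach prom].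
- apply: le_trans (_ : (m * d * 3 + nsum m d *
    (size (code d).1 + d * d * 5))%:R <= _).
    by rewrite ler_nat run_time_init.
  rewrite natrD !natrM natrD !natrM -expr2.
  set X := m%:R * d%:R `^ (W - 1).
  have md_le : m%:R * d%:R <= X by rewrite ler_wpM2l.
  have block_le : (nsum m d)%:R * ((size (code d).1)%:R + d%:R ^+ 2 * 5)
      <= (C + 5) * X.
    apply: le_trans (_ : (nsum m d)%:R * ((C + 5) * d%:R `^ W) <= _).
      by rewrite ler_wpM2l //; lra.
    rewrite -dW mulrCA; apply: ler_wpM2l; first by rewrite addr_ge0.
    by rewrite mulrA ler_wpM2r ?powR_ge0.
  have := mulr_ge0 c_ge0 (le_trans (mulr_ge0 (ler0n _ m) (ler0n _ d)) md_le).
  lra.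
- apply: le_trans
    (_ : (1 + m * d + nsum m d * (d * d) + nsum m d * N)%:R <= _).
    by rewrite ler_nat space_init.
  rewrite !natrD !natrM -expr2.
  set X := m%:R * d%:R.
  have X_ge1 : 1 <= X by rewrite mulr_ege1.
  have sum_le : (nsum m d)%:R * d%:R ^+ 2 <= X by rewrite expr2 mulrA ler_wpM2r.
  have N_sum_le : (nsum m d)%:R * N%:R <= C * X.
    apply: le_trans (_ : (nsum m d)%:R * (C * d%:R ^+ 2) <= _).
      by rewrite ler_wpM2l.
    by rewrite mulrCA ler_wpM2l.
  have := mulr_ge0 c_ge0 (le_trans ler01 X_ge1).
  lra.
split; first exact: (prefix_structureP sP m_gt0 d_gt0 mu_reach prom).
set K := up_log 2 (nsum m d).+1.
apply: le_trans (_ : (K * (d * d).*2.+2 +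
    (size (code d).1 + d * d.*2.+2))%:R <= _).
  by rewrite ler_nat run_time_search.
apply: le_trans
  (_ : (K * (4 * (d * d)) + (size (code d).1 + 4 * (d * d)))%:R <= _).
  have dd_gt0 : (0 < d * d)%N by rewrite muln_gt0 d_gt0.
  have dd_le : ((d * d).*2.+2 <= 4 * (d * d))%N.
    by move: (d * d)%N dd_gt0; clear; lia.
  have d_dd_le : (d * d.*2.+2 <= 4 * (d * d))%N.
    by rewrite mulnCA leq_mul2l; apply/orP; right; clear -d_gt0; lia.
  by rewrite ler_nat leq_add ?leq_add2l // leq_mul2l dd_le orbT.
rewrite !natrD !natrM -expr2.
have K_le : K%:R <= 1 + ln m%:R / ln 2 :> R by apply: up_log2_le.
have : K%:R * (4 * d%:R ^+ 2) <= (1 + ln m%:R / ln 2) * (4 * d%:R ^+ 2) :> R.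
  by rewrite ler_wpM2r ?mulr_ge0.
have -> : (1 + ln m%:R / ln 2) * (4 * d%:R ^+ 2) =
  4 * d%:R ^+ 2 + 4 / ln 2 * (d%:R ^+ 2 * ln m%:R) :> R by ring.
have lnm_ge0 : 0 <= d%:R ^+ 2 * ln m%:R :> R.
  by rewrite mulr_ge0 ?exprn_ge0 ?ln_ge0.
have := mulr_ge0 C_ge0 lnm_ge0.
have := mulr_ge0 c_ge0 (powR_ge0 d%:R W).
lra.
Qed.
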